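(* For every constant $C>0$ there exist constants $C'>0$ and $a>0$, depending only on $C$, such that the following holds. Let $\varepsilon\ge0$, let $S\ge2$ and $n\ge2$ be integers with $\ln n\ge C\ln S$, and let $P=(p_1,\dots,p_S)\in\mathcal{M}_S$ satisfy $$\sum_{j=1}^S p_j\wedge\sqrt{\frac{e^\varepsilon p_j}{n\ln n}}\;\ge\;C'\left(\sqrt{\frac{e^\varepsilon\ln n}{n}}+\frac{e^\varepsilon\sqrt S\,\ln n}{n}\right).$$ Then $$\inf_{\widehat d_\varepsilon(P\|Q_n)}\;\sup_{Q\in\mathcal{M}_S}\mathbb{E}_Q\Big[\big|\widehat d_\varepsilon(P\|Q_n)-d_\varepsilon(P\|Q)\big|^2\Big]\;\ge\;a\Big(\sum_{i=1}^S p_i\wedge\sqrt{\frac{e^\varepsilon p_i}{n\ln n}}\Big)^2,$$ where the infimum is over all estimators, i.e. all (measurable) real-valued functions of $Q_n$, which may depend on the known quantities $P,\varepsilon,n,S$.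
   Context: $\mathcal{M}_S$ is the set of probability distributions on $[S]=\{1,\dots,S\}$; $x\wedge y=\min\{x,y\}$, $[x]^+=\max\{x,0\}$; $d_\varepsilon(P\|Q)=\sum_{i=1}^S[p_i-e^\varepsilon q_i]^+$. Sampling model (Poisson sampling, expected sample size $n$): $Q_n=(\hat q_1,\dots,\hat q_S)$ with $\hat q_1,\dots,\hat q_S$ independent and $n\hat q_i\sim\mathrm{Poi}(nq_i)$ (the counts of $N\sim\mathrm{Poi}(n)$ i.i.d. samples from $Q$, divided by $n$). $\mathbb{E}_Q$ is expectation over $Q_n$. *)

(* Defs.v *)
From HB Require Import structures.
From mathcomp Require Import all_boot all_order all_algebra.
From mathcomp Require Import all_classical all_reals all_analysis.

Set Implicit Arguments.
Unset Strict Implicit.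
Unset Printing Implicit Defensive.

Import Order.TTheory GRing.Theory Num.Theory.
Import numFieldNormedType.Exports.

Local Open Scope classical_set_scope.
Local Open Scope ring_scope.

Section esum_product.
Context {R : realType}.
Local Open Scope ereal_scope.

Lemma esumZl (T : choiceType) (I : set T) (r : R) (a : T -> \bar R) :
  (0 <= r)%R -> (forall i, 0 <= a i) ->
  \esum_(i in I) (r%:E * a i) = r%:E * \esum_(i in I) a i.
Proof.
have le1 (s : R) (b : T -> \bar R) : (0 <= s)%R -> (forall i, 0 <= b i) ->
    \esum_(i in I) (s%:E * b i) <= s%:E * \esum_(i in I) b i.
  move=> s0 b0; apply: ge_ereal_sup => _ [X [finX XI] <-].
  rewrite -ge0_mule_fsumr//; apply: lee_wpmul2l; first by rewrite lee_fin.
  by apply: esum_ge; exists X.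
move=> r0 a0; apply/eqP; rewrite eq_le le1//=.
have [<-|rN0] := eqVneq 0%R r.
  by rewrite mul0e; apply: esum_ge0 => i _; rewrite mul0e.
have {rN0}r0 : (0 < r)%R by rewrite lt_neqAle rN0.
have rV0 : (0 <= r^-1)%R by rewrite invr_ge0 ltW.
have ra0 i : 0 <= r%:E * a i by rewrite mule_ge0// lee_fin ltW.
have /(lee_wpmul2l (ltW r0 : 0 <= r%:E)) := le1 _ _ rV0 ra0.
rewrite muleA -EFinM divff ?gt_eqF// mul1e.
by under eq_esum do rewrite muleA -EFinM mulVf ?gt_eqF// mul1e.
Qed.

Lemma esum_prod n (f : 'I_n -> nat -> R) (A : 'I_n -> set nat) :
  (forall i j, (0 <= f i j)%R) ->
  (forall i, \esum_(j in A i) (f i j)%:E \is a fin_num) ->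
  \esum_(k in [set k : n.-tuple nat | forall i, A i (tnth k i)])
     (\prod_(i < n) f i (tnth k i))%:E =
  \prod_(i < n) \esum_(j in A i) (f i j)%:E.
Proof.
elim: n f A => [|n IH] f A f0 fA.
  rewrite big_ord0 (_ : [set _ | _] = [set [tuple]]); last first.
    apply/seteqP; split=> [k _|k _ [] //] /=; exact: tuple0.
  by rewrite esum_set1 big_ord0.
rewrite big_ord_recl.
pose f' i := f (lift ord0 i); pose A' i := A (lift ord0 i).
rewrite -(IH f' A') => [|i j|i]; [|exact: f0|exact: fA].
pose B := [set k : n.-tuple nat | forall i, A' i (tnth k i)].
rewrite -/B; pose g (k : n.-tuple nat) : R := (\prod_(i < n) f' i (tnth k i))%R.
have g0 k : (0 <= g k)%R by apply: prodr_ge0 => i _; exact: f0.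
transitivity (\esum_(x in A ord0) \esum_(k in B) ((f ord0 x)%:E * (g k)%:E)).
  rewrite esum_esum; last by move=> i k _ _; rewrite mule_ge0 ?lee_fin.
  rewrite (reindex_esum (A ord0 `*`` fun=> B) _
     (fun u : nat * n.-tuple nat => [tuple of u.1 :: u.2])).
    apply: eq_esum => -[x k] _ /=; rewrite big_ord_recl tnth0 -EFinM.
    by congr (_ * _)%:E; apply: eq_bigr => i _; rewrite tnthS.
  split => [[x k] /= [Ax Bk] i|[x k] [y l] _ _ [-> kl]|k Ak].
  - by case: (unliftP ord0 i) => [j ->|->]; rewrite ?tnthS ?tnth0//; exact: Bk.
  - by congr (_, _); exact: val_inj.
  - exists (thead k, [tuple of behead k]) => /=; last by rewrite -tuple_eta.
    split => /= [|i]; first exact: Ak.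
    rewrite /A' tnth_behead; suff -> : inord i.+1 = lift ord0 i by exact: Ak.
    by apply: val_inj; rewrite /= inordK// ltnS.
under eq_esum do rewrite esumZl//.
set G := \esum_(k in B) _.
have G0 : 0 <= G by apply: esum_ge0 => k _; rewrite lee_fin.
have Gfin : G \is a fin_num.
  rewrite /G (IH f' A') => [|i j|i]; [|exact: f0|exact: fA].
  by elim/big_ind: _ => [|x y|i _]; [|exact: fin_numM|exact: fA].
rewrite -(fineK Gfin) muleC -esumZl ?fine_ge0//; last first.
  by move=> x; rewrite lee_fin.
by apply: eq_esum => x _; rewrite muleC.
Qed.

Lemma probability_nat_esum (mu : probability nat R) (A : set nat) :
  mu A = \esum_(k in A) (fine (mu [set k]))%:E.
Proof.
transitivity (\esum_(k in A) mu [set k]); last first.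
  by apply: eq_esum => k _; rewrite fineK// fin_num_measure.
have {1}-> : A = \bigcup_(k in A) [set k] by rewrite bigcup_imset1 image_id.
rewrite measure_bigcup//; last by apply/trivIsetP => i j _ _ ij;
  rewrite -subset0 => k [/= ->]; exact/eqP.
by rewrite nneseries_esum//; congr esum; apply/seteqP; split => x /=;
  rewrite inE.
Qed.
End esum_product.

(* The joint law of independent natural numbers with laws mu 0, ..., mu (S - 1);
   the library has no S-fold product measure. *)
Definition product_nat {R : realType} (S : nat) (mu : 'I_S -> probability nat R)
    (A : set (S.-tuple nat)) : \bar R :=
  \esum_(k in A) (\prod_(i < S) fine (mu i [set tnth k i]))%:E.

Section product_nat_probability.
Context {R : realType} (S : nat) (mu : 'I_S -> probability nat R).
Local Open Scope ereal_scope.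

Lemma product_nat_mass_ge0 (k : S.-tuple nat) :
  0 <= (\prod_(i < S) fine (mu i [set tnth k i]))%:E.
Proof. by rewrite lee_fin; apply: prodr_ge0 => i _; exact: fine_ge0. Qed.

Lemma product_nat_box (A : 'I_S -> set nat) :
  product_nat mu [set k | forall i, A i (tnth k i)] = \prod_(i < S) mu i (A i).
Proof.
rewrite /product_nat (esum_prod (f := fun i j => fine (mu i [set j]))).
- by apply: eq_bigr => i _; rewrite -probability_nat_esum.
- by move=> i j; exact: fine_ge0.
- by move=> i; rewrite -probability_nat_esum fin_num_measure.
Qed.

Let product_nat0 : product_nat mu set0 = 0.
Proof. exact: esum_set0. Qed.

Let product_nat_ge0 A : 0 <= product_nat mu A.
Proof. by apply: esum_ge0 => k _; exact: product_nat_mass_ge0. Qed.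

Let product_nat_sigma_additive : semi_sigma_additive (product_nat mu).
Proof.
move=> F mF tF mUF; apply: cvg_toP.
  apply: ereal_nondecreasing_is_cvgn => a b ab.
  by apply: lee_sum_nneg_natr.
rewrite /product_nat nneseries_sum_bigcup// => k.
exact: product_nat_mass_ge0.
Qed.

HB.instance Definition _ := isMeasure.Build _ _ _ (product_nat mu)
  product_nat0 product_nat_ge0 product_nat_sigma_additive.

Let product_nat_setT : product_nat mu setT = 1.
Proof.
transitivity (product_nat mu [set k | forall i, [set: nat] (tnth k i)]).
  by congr product_nat; apply/seteqP; split.
rewrite (product_nat_box (fun=> setT)) big1// => i _.
exact: probability_setT.
Qed.

HB.instance Definition _ :=
  @Measure_isProbability.Build _ _ R (product_nat mu) product_nat_setT.

End product_nat_probability.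

(* The law of the counts n \hat q_1, ..., n \hat q_S, which are independent and
   Poi(n q_i). The Poisson law with rate 0 is the Dirac mass at 0; the last
   argument of [poisson_prob] is unused in its definition. *)
Definition poisson_sample {R : realType} (S n : nat) (Q : S.-tuple R) :
    probability (S.-tuple nat) R :=
  product_nat (fun i => poisson_prob (n%:R * tnth Q i) 0).

Definition empirical {R : realType} (S n : nat) (k : S.-tuple nat) :
    S.-tuple R :=
  [tuple (tnth k i)%:R / n%:R | i < S].

Definition distributions {R : realType} (S : nat) : set (S.-tuple R) :=
  [set p | (forall i, 0 <= tnth p i) /\ \sum_(i < S) tnth p i = 1].
Arguments distributions {R} S.

Definition hockey_stick {R : realType} (S : nat) (eps : R)
    (P Q : S.-tuple R) : R :=
  \sum_(i < S) Num.max (tnth P i - expR eps * tnth Q i) 0.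

Definition risk {R : realType} (S n : nat) (eps : R) (P : S.-tuple R)
    (dhat : S.-tuple R -> R) (Q : S.-tuple R) : \bar R :=
  'E_(poisson_sample n Q)[fun k =>
    `|dhat (empirical n k) - hockey_stick eps P Q| ^+ 2].

Definition minimax_risk {R : realType} (S n : nat) (eps : R)
    (P : S.-tuple R) : \bar R :=
  ereal_inf [set ereal_sup [set risk n eps P dhat Q | Q in distributions S]
            | dhat in [set f : S.-tuple R -> R | measurable_fun setT f]].

Definition rate_sum {R : realType} (S n : nat) (eps : R) (P : S.-tuple R) : R :=
  \sum_(j < S)
    Num.min (tnth P j)
            (Num.sqrt (expR eps * tnth P j / (n%:R * ln n%:R))).

(* Main.v *)
Require Import Defs.
From mathcomp Require Import all_boot all_order all_algebra.
From mathcomp Require Import all_classical all_reals all_analysis.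
From mathcomp Require Import ring lra zify.

Set Implicit Arguments.
Unset Strict Implicit.
Unset Printing Implicit Defensive.

Import Order.TTheory GRing.Theory Num.Theory.
Import numFieldNormedType.Exports.

Local Open Scope classical_set_scope.
Local Open Scope ring_scope.

(* Le Cam's method with two mixtures. On the circle the weights
   [(1 -+ (-1) ^ i) G (phi_i)] at the nodes [phi_i = i pi / (8 M)], with [G] of
   degree [4 M], define two laws of [x = - cos phi] with the same moments below
   [4 M], because the sign [(-1) ^ i] is the frequency [8 M]; a Fejer kernel
   concentrated near the kink makes the means of [(t - x)^+] differ by order
   [1 / M]. For [M] of order [ln n], a coordinate of [Q] near [p_j e^-eps] is
   drawn from an affine image of either law. Poisson likelihood ratios turn into
   exponentials of products of shifts, so the matching moments make the two
   mixtures of one coordinate [n ^ -T]-close; exchanging the coordinates one by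
   one costs a factor [S <= n ^ (1 / C)]. The means of [d_eps (P || Q)] differ by
   a multiple of the rate, while its fluctuations are of the order of the right
   side of the hypothesis on [P]. *)

(** * Fejer kernels on equispaced nodes *)

(** The obstacle is that [Q] must have total mass exactly one, so its coordinates cannot all be
    independent. One coordinate [m] compensates the others, and it must neither betray the prior nor
    enter [d_eps]. The first demand is why closeness is proved for shifts of two rates at once, [a]
    upwards and [b] downwards. The second is met while the random mass stays below a threshold,
    which is why [m] is set aside before the set of random coordinates is thinned out. Closeness is
    not obtained by integrating a likelihood ratio: a quadratic form in the prior weights,
    nonnegative on every event, plays the role of the chi-square distance, so that only finite sums
    over priors occur. Discrete nodes instead of densities serve the same purpose. The scale [M0],
    of order [ln n / n], separates two kinds of coordinates: above it a rate is perturbed by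
    [sqrt (M0 tau)] around its mean [tau]; below it the support starts at 0, has length at most
    [2 M0], and its kink is moved towards 0, since a kink in the middle would be too far from
    [tau]. *)

Section trigonometric_sums.
Context {R : realType}.
Implicit Types x y e : R.

Lemma cosMcos x y : cos x * cos y = (cos (x + y) + cos (x - y)) / 2.
Proof. by rewrite (cosD x y) (cosB x y); field. Qed.

Lemma cosMsin x y : cos x * sin y = (sin (x + y) - sin (x - y)) / 2.
Proof. by rewrite (sinD x y) (sinB x y); field. Qed.

Lemma cosBcos x y : cos (x - y) - cos (x + y) = 2 * sin x * sin y.
Proof. by rewrite (cosD x y) (cosB x y); ring. Qed.

Lemma cosD_nat2pi e r : cos (e + r%:R * (pi *+ 2)) = cos e.
Proof. by rewrite mulr_natl (periodicn (@cosD2pi R)). Qed.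

Lemma sinD_nat2pi e r : sin (e + r%:R * (pi *+ 2)) = sin e.
Proof. by rewrite mulr_natl (periodicn (@sinD2pi R)). Qed.

Lemma sum_cos_arith n (d e : R) :
  2 * sin (d / 2) * (\sum_(i < n) cos (i%:R * d + e)) =
  sin (n%:R * d + e - d / 2) - sin (e - d / 2).
Proof.
elim: n => [|n IH]; first by rewrite big_ord0 mulr0 mul0r add0r subrr.
rewrite big_ord_recr /= mulrDr IH -[n.+1%:R]natr1.
rewrite (_ : (n%:R + 1) * d + e - d / 2 = (n%:R * d + e) + d / 2); last by field.
by rewrite (sinB (n%:R * d + e)) (sinD (n%:R * d + e)); ring.
Qed.

(** [n h] is a full turn, so the telescoped sum returns to its start; the factor
    [sin (d / 2) = sin (r pi / n)] is positive because [0 < r < n]. *)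
Lemma sum_cos_roots n r h e : n%:R * h = pi *+ 2 -> (0 < r < n)%N ->
  \sum_(i < n) cos (i%:R * (r%:R * h) + e) = 0.
Proof.
move=> hn /andP[r0 rn]; have n0 : (0 < n%:R :> R) by rewrite ltr0n (leq_trans _ rn).
set d := r%:R * _.
have /eqP := sum_cos_arith n d e.
rewrite (_ : n%:R * d + e - d / 2 = e - d / 2 + r%:R * (pi *+ 2)); last first.
  by rewrite /d -hn; ring.
rewrite sinD_nat2pi subrr !mulf_eq0 pnatr_eq0/= => /orP[/eqP s0|/eqP//].
have : 0 < sin (d / 2).
  have dE : n%:R * (d / 2) = r%:R * pi.
    by have : n%:R * (d / 2) = r%:R * (n%:R * h) / 2; [rewrite /d; field|rewrite hn => ->; field].
  have d0 : 0 < d / 2 by rewrite -(pmulr_rgt0 _ n0) dE mulr_gt0 ?pi_gt0// ltr0n.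
  apply: sin_gt0_pi; rewrite d0/= -(ltr_pM2l n0) dE ltr_pM2r ?pi_gt0// ltr_nat//.
by rewrite s0 ltxx.
Qed.

Lemma sin_le_id x : 0 <= x -> sin x <= x.
Proof.
move=> x0; have [c _] := @MVT_segment R sin cos 0 x x0
  (fun y _ => is_derive_sin y) (continuous_subspaceT (@continuous_sin R)).
by rewrite sin0 !subr0 => ->; rewrite ler_piMl// cos_le1.
Qed.

Lemma cos_ge_half x : 0 <= x <= pi / 4 -> 1 / 2 <= cos x.
Proof.
move=> /andP[x0 x4]; have pi0 := @pi_gt0 R.
have c0 : 0 <= cos x by apply: cos_ge0_pihalf; apply/andP; split; lra.
have : 0 <= cos (x *+ 2) by apply: cos_ge0_pihalf; apply/andP; split; lra.
rewrite cos_mulr2n mulr2n => ?; nra.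
Qed.

Lemma sin_ge_half_id x : 0 <= x <= pi / 4 -> x / 2 <= sin x.
Proof.
move=> /andP[x0 x4]; have [c] := @MVT_segment R sin cos 0 x x0
  (fun y _ => is_derive_sin y) (continuous_subspaceT (@continuous_sin R)).
rewrite in_itv/= => /andP[c0 cx]; rewrite sin0 !subr0 => ->.
by have := @cos_ge_half c; rewrite c0 (le_trans cx)// => /(_ isT); nra.
Qed.

Lemma ler_sin : {in `[(- (pi / 2)), pi / 2] &, {mono sin : x y / x <= y :> R}}.
Proof. by apply: le_mono_in => x y xD yD; rewrite ltr_sin. Qed.

Definition dirichlet r x : R := 1 + 2 * \sum_(j < r) cos (j.+1%:R * x).
(** Unnormalised, [m] times the usual Fejer kernel: its value is [(1 - cos (m x)) / (1 - cos x)]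
    wherever [cos x] is not 1. *)
Definition fejer m x : R := \sum_(r < m) dirichlet r x.

Lemma dirichletE r x :
  dirichlet r x * (1 - cos x) = cos (r%:R * x) - cos (r.+1%:R * x).
Proof.
elim: r => [|r IH]; first by rewrite /dirichlet big_ord0 mulr0 addr0 !mul1r mul0r cos0.
have -> : dirichlet r.+1 x = dirichlet r x + 2 * cos (r.+1%:R * x).
  by rewrite /dirichlet big_ord_recr/= mulrDr addrA.
rewrite mulrDl IH; have := cosMcos (r.+1%:R * x) x.
rewrite -[r.+2%:R]natr1 (_ : r.+1%:R * x - x = r%:R * x); last by rewrite -[r.+1%:R]natr1; ring.
rewrite (_ : r.+1%:R * x + x = (r.+1%:R + 1) * x); last by ring.
by move=> E; rewrite mulrBr mulr1 -mulrA E; field.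
Qed.

Lemma fejerE m x : fejer m x * (1 - cos x) = 1 - cos (m%:R * x).
Proof.
rewrite /fejer mulr_suml; under eq_bigr do rewrite dirichletE.
elim: m => [|m IH]; first by rewrite big_ord0 mul0r cos0 subrr.
by rewrite big_ord_recr/= IH; ring.
Qed.

(** Shows that [fejer m x * sin x] is a sum of pure sines of frequency at most [m], hence sums to
    zero over the nodes. *)
Lemma dirichletMsin r x : dirichlet r x * sin x = sin (r%:R * x) + sin (r.+1%:R * x).
Proof.
elim: r => [|r IH]; first by rewrite /dirichlet big_ord0 mulr0 addr0 !mul1r mul0r sin0 add0r.
have -> : dirichlet r.+1 x = dirichlet r x + 2 * cos (r.+1%:R * x).
  by rewrite /dirichlet big_ord_recr/= mulrDr addrA.
rewrite mulrDl IH; have := cosMsin (r.+1%:R * x) x.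
rewrite -[r.+2%:R]natr1 (_ : r.+1%:R * x - x = r%:R * x); last by rewrite -[r.+1%:R]natr1; ring.
rewrite (_ : r.+1%:R * x + x = (r.+1%:R + 1) * x); last by ring.
by move=> E; rewrite -mulrA E; field.
Qed.

Lemma cos1_nat x n : cos x = 1 -> cos (n%:R * x) = 1 /\ sin (n%:R * x) = 0.
Proof.
move=> cx; have sx : sin x = 0 by apply: cos1sin0; rewrite cx normr1.
elim: n => [|n [c s]]; first by rewrite mul0r cos0 sin0.
by rewrite -natr1 mulrDl mul1r cosD sinD c s cx sx; split; ring.
Qed.

Lemma fejer_ge0 m x : 0 <= fejer m x.
Proof.
have [c1|c1] := eqVneq (cos x) 1.
  rewrite /fejer/dirichlet; apply: sumr_ge0 => r _.
  by rewrite addr_ge0// mulr_ge0// sumr_ge0// => j _; rewrite (cos1_nat _ c1).1.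
have c0 : 0 < 1 - cos x by rewrite subr_gt0 lt_neqAle c1 cos_le1.
by rewrite -(pmulr_lge0 _ c0) fejerE subr_ge0 cos_le1.
Qed.

End trigonometric_sums.

Section nodes.
Context {R : realType} (n : nat) (h : R).
Hypothesis hn : n%:R * h = pi *+ 2.
Local Notation phi i := (i%:R * h).

Lemma sum_cos_shift r (b : R) : (0 < r < n)%N ->
  \sum_(i < n) cos (r%:R * (phi i + b)) = 0.
Proof.
move=> rn; rewrite -[RHS](sum_cos_roots (r%:R * b) hn rn).
by apply: eq_bigr => i _; congr cos; ring.
Qed.

Lemma sum_sin_shift r (b : R) : (r < n)%N ->
  \sum_(i < n) sin (r%:R * (phi i + b)) = 0.
Proof.
case: r => [_|r rn]; first by rewrite big1// => i _; rewrite mul0r sin0.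
rewrite -[RHS](@sum_cos_roots R n r.+1 h (r.+1%:R * b - pi / 2) hn)//.
by apply: eq_bigr => i _; rewrite -cosBpihalf; congr cos; ring.
Qed.

Lemma sum_fejer m (b : R) : (m <= n)%N ->
  \sum_(i < n) fejer m (phi i + b) = n%:R * m%:R.
Proof.
move=> mn; rewrite /fejer exchange_big/= (eq_bigr (fun=> n%:R)); last first.
  move=> r _; rewrite /dirichlet big_split/= sumr_const card_ord -mulr_sumr exchange_big/=.
  rewrite big1 ?mulr0 ?addr0// => j _; rewrite sum_cos_shift//=.
  by rewrite (leq_ltn_trans _ (leq_trans (ltn_ord r) mn))// ltn_ord.
by rewrite sumr_const card_ord mulr_natr.
Qed.

Lemma sum_fejerMsin m (b : R) : (m < n)%N ->
  \sum_(i < n) fejer m (phi i + b) * sin (phi i + b) = 0.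
Proof.
move=> mn; under eq_bigr do rewrite /fejer mulr_suml.
rewrite exchange_big big1//= => r _.
under eq_bigr do rewrite dirichletMsin.
by rewrite big_split/= !sum_sin_shift ?addr0// (leq_ltn_trans _ mn)// ltnW.
Qed.

(* [f], a function on the [n] equispaced nodes of the circle, behaves like a
   trigonometric polynomial of degree at most [d]: it is orthogonal to all
   frequencies in [d+1, n-d-1]. *)
Definition degree_le (f : nat -> R) d := forall r e, (d < r)%N -> (r + d < n)%N ->
  \sum_(i < n) f i * cos (r%:R * phi i + e) = 0.

Lemma degree_leW f d d' : (d <= d')%N -> degree_le f d -> degree_le f d'.
Proof. by move=> dd' H r e dr rd; apply: H; lia. Qed.

Lemma eq_degree_le f g d : f =1 g -> degree_le f d -> degree_le g d.
Proof. by move=> fg H r e dr rd; rewrite -[RHS](H r e)//; apply: eq_bigr => i _; rewrite fg. Qed.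

Lemma degree_leD f g d : degree_le f d -> degree_le g d ->
  degree_le (fun i => f i + g i) d.
Proof.
move=> Hf Hg r e dr rd; under eq_bigr do rewrite mulrDl.
by rewrite big_split/= Hf// Hg// addr0.
Qed.

Lemma degree_leZ c f d : degree_le f d -> degree_le (fun i => c * f i) d.
Proof.
move=> Hf r e dr rd; under eq_bigr do rewrite -mulrA.
by rewrite -mulr_sumr Hf// mulr0.
Qed.

Lemma degree_le_sum m (f : nat -> nat -> R) d : (forall j, (j < m)%N -> degree_le (f j) d) ->
  degree_le (fun i => \sum_(j < m) f j i) d.
Proof.
move=> Hf r e dr rd; under eq_bigr do rewrite mulr_suml.
by rewrite exchange_big big1//= => j _; rewrite Hf.
Qed.

Lemma degree_le1 : degree_le (fun=> 1) 0.
Proof.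
move=> r e r0 rn; rewrite -[RHS](@sum_cos_roots R n r h e hn); last by rewrite r0 -[r]addn0.
by apply: eq_bigr => i _; rewrite mul1r; congr cos; ring.
Qed.

(** Product-to-sum moves the frequency [r] to [r + j] and [r - j], both still in the window where
    [f] is orthogonal; [r - j] is not truncated since [d + j < r]. *)
Lemma degree_leMcos f d j e : degree_le f d ->
  degree_le (fun i => f i * cos (j%:R * phi i + e)) (d + j).
Proof.
move=> Hf r e' dr rd.
transitivity ((\sum_(i < n) f i * cos ((r + j)%:R * phi i + (e + e')) +
  \sum_(i < n) f i * cos ((r - j)%:R * phi i + (e' - e))) / 2).
  rewrite -big_split/= mulr_suml; apply: eq_bigr => i _.
  rewrite -mulrA [cos _ * _]mulrC cosMcos -mulrDr -mulrA.
  by congr (f i * ((cos _ + cos _) / 2)); rewrite ?natrD ?natrB; [ring|ring|lia].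
by rewrite !Hf ?addr0 ?mul0r//; lia.
Qed.

Lemma degree_le_cos j e : degree_le (fun i => cos (j%:R * phi i + e)) j.
Proof.
apply: (@eq_degree_le (fun i => 1 * cos (j%:R * phi i + e))); first by move=> i; rewrite mul1r.
exact: (@degree_leMcos _ 0 _ _ degree_le1).
Qed.

Lemma degree_le_sin j e : degree_le (fun i => sin (j%:R * phi i + e)) j.
Proof.
apply: (@eq_degree_le (fun i => cos (j%:R * phi i + (e - pi / 2)))).
  by move=> i; rewrite addrA cosBpihalf.
exact: degree_le_cos.
Qed.

Lemma degree_le_fejer m b : degree_le (fun i => fejer m (phi i + b)) m.-1.
Proof.
apply: (@degree_le_sum _ (fun r i => dirichlet r (phi i + b))) => r rm.
apply: degree_leD; first exact: degree_leW degree_le1.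
apply: degree_leZ; apply: (@degree_le_sum _ (fun j i => cos (j.+1%:R * (phi i + b)))) => j jr.
apply: (@eq_degree_le (fun i => cos (j.+1%:R * phi i + j.+1%:R * b))).
  by move=> i; rewrite mulrDr.
by apply: (degree_leW _ (@degree_le_cos _ _)); lia.
Qed.

Lemma degree_le_fejerMsin m b : degree_le (fun i => fejer m (phi i + b) * sin (phi i + b)) m.
Proof.
apply: (@eq_degree_le (fun i => \sum_(r < m) (sin (r%:R * phi i + r%:R * b) +
   sin (r.+1%:R * phi i + r.+1%:R * b)))).
  move=> i; rewrite /fejer mulr_suml; apply: eq_bigr => r _.
  by rewrite dirichletMsin !mulrDr.
apply: (@degree_le_sum _ (fun r i => sin (r%:R * phi i + r%:R * b) +
   sin (r.+1%:R * phi i + r.+1%:R * b))) => r rm.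
by apply: degree_leD; apply: (degree_leW _ (@degree_le_sin _ _)); lia.
Qed.

Lemma degree_leMcosX f d j : degree_le f d ->
  degree_le (fun i => f i * cos (phi i) ^+ j) (d + j).
Proof.
elim: j => [|j IH] Hf.
  by rewrite addn0; apply: eq_degree_le Hf => i; rewrite expr0 mulr1.
rewrite (_ : d + j.+1 = (d + j) + 1)%N; last by rewrite addn1 addnS.
apply: eq_degree_le (@degree_leMcos _ _ 1 0 (IH Hf)) => i.
by rewrite exprSr addr0 mul1r -[LHS]mulrA.
Qed.

End nodes.

(** * Two laws with matching moments *)

Lemma sum_blocks4 {R : realType} n (a : nat -> R) : \sum_(i < 4 * n) a i =
  \sum_(b < n) (a (4 * b)%N + a (4 * b + 1)%N + a (4 * b + 2)%N + a (4 * b + 3)%N).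
Proof.
elim: n => [|n IH]; first by rewrite muln0 !big_ord0.
rewrite [RHS]big_ord_recr/= -IH (_ : 4 * n.+1 = (4 * n).+4)%N; last by lia.
by rewrite !big_ord_recr/= !addrA !addnS !addn0.
Qed.

(** Both ends of the arc are multiples of four, so an arc containing the third node of a block
    contains its last three; the first may sit on the kink. *)
Lemma block_indices b c K M : (c < 4)%N -> (b < 4 * M)%N ->
  (4 * b + 2 < 4 * K)%N || (16 * M - 4 * K < 4 * b + 2)%N ->
  (4 * b + c < 16 * M)%N /\
  ((0 < c)%N -> (4 * b + c < 4 * K)%N || (16 * M - 4 * K < 4 * b + c)%N).
Proof. lia. Qed.

Section extremal_pair.
Context {R : realType} (M K : nat) (h beta : R).
Hypotheses (K0 : (0 < K)%N) (KM : (K <= M)%N).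
Hypotheses (hM : 8 * M%:R * h = pi) (betaE : beta = (4 * K)%:R * h).
Local Notation n := (16 * M)%N.
Local Notation phi i := (i%:R * h).
Local Notation sb := (sin beta).
Local Notation cb := (cos beta).
Local Notation D i := (cos (phi i) - cb).
Local Notation F x := (fejer (4 * M) x).
Local Notation s i := (1 - cos ((4 * M)%:R * phi i)).

(* With [s i = 1 - cos (4 M phi_i)], of period 4 in [i], the identities [kernMD]
   and [GMD] below say that [kern = 2 sb s / D] and [G = 2 sb ^ 3 s / D ^ 2]: a
   nonnegative kernel of degree [4 M] peaked at the kink [beta] of the positive
   part, so that [G D^+] sums like a second difference of [1 / D]. *)
Let kern i : R := F (phi i + beta) * sin (phi i + beta) - F (phi i + (- beta)) * sin (phi i + (- beta)).
Let G i : R := sb * (F (phi i + beta) + F (phi i + (- beta))) + cb * kern i.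

Let M0 : 0 < M%:R :> R.
Proof. by rewrite ltr0n; lia. Qed.

Let hn : n%:R * h = pi *+ 2.
Proof. by rewrite -hM natrM; ring. Qed.

Let pi0 : 0 < pi :> R.
Proof. exact: pi_gt0. Qed.

Let h0 : 0 < h.
Proof. by have := pi0; rewrite -hM pmulr_rgt0// mulr_gt0. Qed.

Let beta0 : 0 < beta.
Proof. by rewrite betaE mulr_gt0// ltr0n; lia. Qed.

Let beta_pihalf : beta <= pi / 2.
Proof.
rewrite (_ : pi / 2 = (4 * M)%:R * h); last by rewrite -hM !natrM; field.
by rewrite betaE ler_pM2r// ler_nat; lia.
Qed.

Let sb0 : 0 < sb.
Proof. by apply: sin_gt0_pi; apply/andP; split; have := beta0; have := beta_pihalf; have := pi0; move=> *; lra. Qed.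

Let cb0 : 0 <= cb.
Proof. by apply: cos_ge0_pihalf; apply/andP; split; have := beta0; have := beta_pihalf; have := pi0; move=> *; lra. Qed.

(** The reason for taking [beta] a multiple of [4 h]: [4 M beta = 2 pi K], so both shifted kernels
    have the same numerator [s]. *)
Let cos_period i : cos ((4 * M)%:R * (phi i + beta)) = cos ((4 * M)%:R * phi i).
Proof.
rewrite -[RHS](cosD_nat2pi _ K); congr cos; rewrite mulrDr; congr (_ + _).
by rewrite betaE -hM !natrM; ring.
Qed.

Let cos_periodN i : cos ((4 * M)%:R * (phi i + (- beta))) = cos ((4 * M)%:R * phi i).
Proof.
rewrite -[LHS](cosD_nat2pi _ K); congr cos; by rewrite mulrDr betaE -hM !natrM; ring.
Qed.

Let FE i : F (phi i + beta) * (1 - cos (phi i + beta)) = s i.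
Proof. by rewrite fejerE cos_period. Qed.

Let FEN i : F (phi i + (- beta)) * (1 - cos (phi i + (- beta))) = s i.
Proof. by rewrite fejerE cos_periodN. Qed.

Let prodE i : (1 - cos (phi i + beta)) * (1 - cos (phi i + (- beta))) = D i ^+ 2.
Proof.
rewrite cosB cosD.
transitivity ((1 - cos (phi i) * cb) ^+ 2 - sin (phi i) ^+ 2 * sb ^+ 2); first by ring.
by rewrite !sin2cos2; ring.
Qed.

(* At the zeros of [D] the conjugate kernel vanishes, which is why the
   identities below need no exception there. *)
Let degenerate i : D i = 0 -> [/\ kern i = 0, s i = 0 & 0 <= G i].
Proof.
move=> D0; have /eqP := prodE i; rewrite D0 expr0n/= mulf_eq0 !subr_eq0.
have aux x y : y = x + 2 * beta \/ y = x - 2 * beta -> 1 == cos x -> cos ((4 * M)%:R * x) = cos ((4 * M)%:R * y) ->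
   [/\ sin x = 0, F y = 0 & cos ((4 * M)%:R * x) = 1].
  move=> yx /eqP/esym cx ce; have sx : sin x = 0 by apply: cos1sin0; rewrite cx normr1.
  have Fy : F y = 0.
    have := fejerE (4 * M) y; rewrite -ce (cos1_nat _ cx).1 subrr => /eqP.
    rewrite mulf_eq0 => /orP[/eqP//|].
    have -> : cos y = cos (beta *+ 2).
      by rewrite -mulr_natl; case: yx => ->; rewrite cosD ?cosN cx sx !mul1r mul0r subr0.
    rewrite cos_mulr2n => /eqP E; exfalso.
    have := cos2Dsin2 beta; have : 0 < sb ^+ 2 by rewrite exprn_gt0.
    move: E; rewrite mulr2n; lra.
  by split => //; rewrite (cos1_nat _ cx).1.
have FF x : 0 <= sb * F x by rewrite mulr_ge0 ?fejer_ge0// ltW.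
move=> /orP[c1|c1].
  have [||sx Fy cx] := aux _ (phi i + (- beta)) _ c1.
  - by right; ring.
  - by rewrite cos_period cos_periodN.
  have k0 : kern i = 0 by rewrite /kern sx Fy mulr0 mul0r subr0.
  split => //; first by rewrite -cos_period cx subrr.
  by rewrite /G k0 mulr0 addr0 Fy addr0.
have [||sx Fy cx] := aux _ (phi i + beta) _ c1.
- by left; ring.
- by rewrite cos_period cos_periodN.
have k0 : kern i = 0 by rewrite /kern sx Fy mulr0 mul0r subr0.
split => //; first by rewrite -cos_periodN cx subrr.
by rewrite /G k0 mulr0 addr0 Fy add0r.
Qed.

Let kernMD i : kern i * D i = 2 * sb * s i.
Proof.
have [D0|D0] := eqVneq (D i) 0.
  by have [-> -> _] := degenerate D0; rewrite !mul0r mulr0.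
apply: (mulIf D0); transitivity (kern i * D i ^+ 2); first by rewrite expr2 mulrA.
rewrite -prodE /kern.
transitivity ((F (phi i + beta) * (1 - cos (phi i + beta))) * sin (phi i + beta) * (1 - cos (phi i + (- beta)))
  - (F (phi i + (- beta)) * (1 - cos (phi i + (- beta)))) * sin (phi i + (- beta)) * (1 - cos (phi i + beta))); first by ring.
rewrite FE FEN cosB sinB (cosD _ beta) (sinD _ beta).
have := cos2Dsin2 beta; have := cos2Dsin2 (phi i).
set c := cos (phi i); set t := sin (phi i); set c' := cb; set t' := sb; set S := s i => E1 E2.
transitivity (2 * t' * S * (c - c' * (c ^+ 2 + t ^+ 2))); first by ring.
by rewrite E1; ring.
Qed.

Let GMD i : G i * D i = sb ^+ 2 * kern i.
Proof.
have [D0|D0] := eqVneq (D i) 0.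
  by have [-> _ _] := degenerate D0; rewrite D0 !mulr0.
apply: (mulIf D0); rewrite -[RHS]mulrA kernMD.
transitivity (sb * (F (phi i + beta) + F (phi i + (- beta))) * D i ^+ 2 + cb * (kern i * D i) * D i).
  by rewrite /G; ring.
rewrite kernMD -prodE.
transitivity (sb * ((F (phi i + beta) * (1 - cos (phi i + beta))) * (1 - cos (phi i + (- beta)))
  + (F (phi i + (- beta)) * (1 - cos (phi i + (- beta)))) * (1 - cos (phi i + beta))) + cb * (2 * sb * s i * D i)); first by ring.
rewrite FE FEN cosB (cosD _ beta).
have := cos2Dsin2 beta.
set c := cos (phi i); set t := sin (phi i); set c' := cb; set t' := sb; set S := s i => E2.
transitivity (2 * t' * S * (1 - c' ^+ 2)); first by ring.
by rewrite -E2; ring.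
Qed.

Let s0 i : 0 <= s i.
Proof. by rewrite subr_ge0 cos_le1. Qed.

Let G0 i : 0 <= G i.
Proof.
have [D0|D0] := eqVneq (D i) 0; first by have [] := degenerate D0.
have D2 : 0 < D i ^+ 2 by rewrite exprn_even_gt0.
rewrite -(pmulr_lge0 _ D2) expr2 mulrA GMD -mulrA kernMD !mulr_ge0//; exact: ltW.
Qed.

Let sum_kern : \sum_(i < n) kern i = 0.
Proof. by rewrite sumrB !(sum_fejerMsin hn) ?subrr//; move: K0 KM; clear; lia. Qed.

Let W : R := 128 * M%:R ^+ 2 * sb.

Let sumG : \sum_(i < n) G i = W.
Proof.
rewrite big_split/= -!mulr_sumr big_split/= sum_kern !(sum_fejer hn); try by clear; lia.
by rewrite /W !natrM; ring.
Qed.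

(** [G D] is a multiple of [kern], which sums to zero, so the mean under [G] is exactly the kink. *)
Let sumGcos : \sum_(i < n) G i * cos (phi i) = W * cb.
Proof.
rewrite (eq_bigr (fun i : 'I_n => sb ^+ 2 * kern i + cb * G i)) => [|i _].
  by rewrite big_split/= -!mulr_sumr sum_kern sumG; ring.
by rewrite -GMD; ring.
Qed.

Let sgn (i : nat) : R := (-1) ^+ i.

Let sgnE i : sgn i = cos ((8 * M)%:R * phi i + 0).
Proof.
rewrite addr0 (_ : _ * phi i = i%:R * pi); last by rewrite -hM !natrM; ring.
rewrite /sgn; elim: i => [|i IH]; first by rewrite mul0r cos0.
by rewrite -natr1 mulrDl mul1r cosDpi exprS IH mulN1r.
Qed.

Let degG : degree_le n h G (4 * M).
Proof.
have degF b : degree_le n h (fun i => F (phi i + b)) (4 * M).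
  by apply: (@degree_leW R n h _ (4 * M).-1 _ _ (@degree_le_fejer R n h hn (4 * M) b)); lia.
apply: degree_leD; first by apply: degree_leZ; exact: degree_leD.
apply: degree_leZ; apply: degree_leD; first exact: (degree_le_fejerMsin hn).
apply: (@eq_degree_le R n h (fun i => -1 * (F (phi i + (- beta)) * sin (phi i + (- beta))))).
  by move=> i; rewrite mulN1r.
apply: degree_leZ; exact: (degree_le_fejerMsin hn).
Qed.

(** [G cos ^ j] has degree [4 M + j < 8 M], and the frequency [8 M] of the sign also lies below
    [16 M - (4 M + j)]. *)
Let moments j : (j < 4 * M)%N -> \sum_(i < n) sgn i * (G i * cos (phi i) ^+ j) = 0.
Proof.
move=> jM; rewrite -[RHS](@degree_leMcosX R n h G (4 * M) j degG (8 * M) 0); try by move: jM; clear; lia.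
by apply: eq_bigr => i _; rewrite mulrC sgnE.
Qed.

(** By [GMD], [G D^+ = sb ^ 2 psi], which trades the double pole of [G] for a simple one. *)
Let psi i : R := if 0 < D i then kern i else 0.

Let Dgt0 i : (i < n)%N -> (0 < D i) = (i < 4 * K)%N || (16 * M - 4 * K < i)%N.
Proof.
move=> iM; rewrite subr_gt0.
have b_in : beta \in `[0, pi].
  rewrite in_itv/=; by apply/andP; split; have := beta0; have := beta_pihalf; have := pi0; move=> *; lra.
have key j : (j <= 8 * M)%N -> (cb < cos (phi j)) = (j < 4 * K)%N.
  move=> jM; have j_in : phi j \in `[0, pi].
    rewrite in_itv/= mulr_ge0 ?(ltW h0)//= -hM ler_pM2r//.
    by rewrite (_ : 8 * M%:R = (8 * M)%:R) ?ler_nat// natrM.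
  by rewrite ltr_cos// betaE ltr_pM2r// ltr_nat.
have [iM8|iM8] := leqP i (8 * M).
  by rewrite key//; move: iM iM8 KM; clear; lia.
rewrite (_ : cos (phi i) = cos (phi (16 * M - i)%N)).
  by rewrite key; move: iM iM8 KM; clear; lia.
rewrite -[RHS]cosN -[RHS](cosD_nat2pi _ 1); congr cos.
by rewrite natrB; [rewrite -hM !natrM; ring|exact: ltnW].
Qed.

(** [s] runs through 0, 1, 2, 1 in each block of four nodes; with alternating signs a block inside
    the arc becomes minus a second difference of [1 / D]. *)
Let sE b c : s (4 * b + c)%N = 1 - cos (c%:R * (pi / 2)).
Proof.
congr (1 - _); rewrite -[RHS](cosD_nat2pi _ b); congr cos.
by rewrite -hM natrD !natrM; field.
Qed.

Let s_0 b : s (4 * b)%N = 0.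
Proof. by rewrite -[(4 * b)%N]addn0 sE mul0r cos0 subrr. Qed.
Let s_1 b : s (4 * b + 1)%N = 1.
Proof. by rewrite sE mul1r cos_pihalf subr0. Qed.
Let s_2 b : s (4 * b + 2)%N = 2.
Proof. by rewrite sE (_ : 2%:R * _ = pi) ?cospi; [ring|field]. Qed.
Let s_3 b : s (4 * b + 3)%N = 1.
Proof.
rewrite sE (_ : 3%:R * _ = pi / 2 + pi); last by field.
by rewrite cosDpi cos_pihalf; ring.
Qed.

Let kernE i : D i != 0 -> kern i = 2 * sb * s i / D i.
Proof. by move=> D0; rewrite -kernMD mulfK. Qed.

Let sgn4 b c : sgn (4 * b + c) = (-1) ^+ c.
Proof. by rewrite /sgn exprD exprM -[X in X ^+ b]signr_odd expr0 expr1n mul1r. Qed.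

Let sgn40 b : sgn (4 * b) = 1.
Proof. by rewrite -[(4 * b)%N]addn0 sgn4. Qed.

Let block b : R := sgn (4 * b) * psi (4 * b) + sgn (4 * b + 1) * psi (4 * b + 1) +
  sgn (4 * b + 2) * psi (4 * b + 2) + sgn (4 * b + 3) * psi (4 * b + 3).

Let block_pos b : (b < 4 * M)%N -> 0 < D (4 * b + 2)%N ->
  [/\ 0 < D (4 * b + 1)%N, 0 < D (4 * b + 3)%N &
   block b = - (2 * sb * ((D (4 * b + 1)%N)^-1 + (D (4 * b + 3)%N)^-1 - 2 / D (4 * b + 2)%N))].
Proof.
move=> bM D2.
have D2' : (4 * b + 2 < 4 * K)%N || (16 * M - 4 * K < 4 * b + 2)%N.
  by move: D2; rewrite Dgt0//; move: bM; clear; lia.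
have [l1 /(_ isT) I1] := @block_indices b 1 K M isT bM D2'.
have [l3 /(_ isT) I3] := @block_indices b 3 K M isT bM D2'.
have D1 : 0 < D (4 * b + 1)%N by rewrite Dgt0.
have D3 : 0 < D (4 * b + 3)%N by rewrite Dgt0.
split => //; rewrite /block /psi D1 D2 D3 !sgn4 sgn40.
have -> : (if 0 < D (4 * b)%N then kern (4 * b)%N else 0) = 0.
  by case: ifPn => // D0; rewrite kernE ?gt_eqF// s_0; ring.
by rewrite !kernE ?gt_eqF// s_1 s_2 s_3; ring.
Qed.

(** Convexity of the inverse with its gap kept, which makes the block at the kink quantitatively
    negative. *)
Let amhm (x y z : R) : 0 < x -> 0 < y -> 0 < z -> x + z <= 2 * y ->
  (z - x) ^+ 2 / (x * z * (x + z)) <= x^-1 + z^-1 - 2 / y.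
Proof.
move=> x0 y0 z0 xz.
have : 4 / (2 * y) <= 4 / (x + z) by rewrite ler_pM2l// lef_pV2// posrE ?addr_gt0// mulr_gt0.
have -> : 4 / (2 * y) = 2 / y by field; rewrite gt_eqF.
have -> : (z - x) ^+ 2 / (x * z * (x + z)) = x^-1 + z^-1 - 4 / (x + z).
  by field; rewrite !gt_eqF// addr_gt0.
lra.
Qed.

(** The two outer cosines add up to [2 cos h] times the middle one, which exceeds [cb >= 0] inside
    the arc. *)
Let concaveD b : 0 < D (4 * b + 2)%N ->
  D (4 * b + 1)%N + D (4 * b + 3)%N <= 2 * D (4 * b + 2)%N.
Proof.
move=> D2.
have -> : phi (4 * b + 1)%N = phi (4 * b + 2)%N - h by rewrite !natrD; ring.
have -> : phi (4 * b + 3)%N = phi (4 * b + 2)%N + h by rewrite !natrD; ring.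
rewrite cosB (cosD _ h); have := cos_le1 h; have := cb0.
move: D2; set y := cos (phi _); set c := cos h; set t := _ * sin h; set c' := cb => D2 ? ?.
nra.
Qed.

Let block_le0 b : (b < 4 * M)%N -> block b <= 0.
Proof.
move=> bM; have [D2|D2] := ltP 0 (D (4 * b + 2)%N).
  have [D1 D3 ->] := block_pos bM D2.
  rewrite oppr_le0 mulr_ge0 ?mulr_ge0 ?(ltW sb0)//.
  apply: le_trans (amhm D1 D2 D3 (concaveD D2)).
  apply: divr_ge0; first exact: sqr_ge0.
  by apply: mulr_ge0; [apply: mulr_ge0|apply: addr_ge0]; exact: ltW.
have psi0 i : 0 <= psi i.
  rewrite /psi; case: ifPn => // D0; rewrite kernE ?gt_eqF// divr_ge0 ?(ltW D0)//.
  by rewrite mulr_ge0 ?s0// mulr_ge0 ?(ltW sb0).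
(* With its third node outside the arc, a block only receives its odd nodes, and these carry the
   sign -1. *)
have -> : block b = - psi (4 * b + 1)%N - psi (4 * b + 3)%N.
  rewrite /block !sgn4 sgn40.
  have -> : psi (4 * b)%N = 0.
    by rewrite /psi; case: ifPn => // D0; rewrite kernE ?gt_eqF// s_0; ring.
  have -> : psi (4 * b + 2)%N = 0 by rewrite /psi ltNge D2.
  by ring.
have := psi0 (4 * b + 1)%N; have := psi0 (4 * b + 3)%N; lra.
Qed.

(** In the block just before the kink, [D] is about [3 h sb], [2 h sb], [h sb] at the last three
    nodes, so the second difference of [1 / D] is of order [1 / (h sb)]. *)
Let block_edge : block K.-1 <= - (36 * h)^-1.
Proof.
have K1M : (K.-1 < 4 * M)%N by move: K0 KM; clear; lia.
have kink : (4 * K.-1 + 2 < 4 * K)%N || (16 * M - 4 * K < 4 * K.-1 + 2)%N.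
  by move: K0; clear; lia.
have D2 : 0 < D (4 * K.-1 + 2)%N.
  by rewrite Dgt0//; move: K0 KM; clear; lia.
have [D1 D3 ->] := block_pos K1M D2.
have phiE c : (c <= 4)%N -> phi (4 * K.-1 + c)%N = beta - (4 - c)%N%:R * h.
  move=> c4; rewrite betaE -mulrBl -natrB; last by move: K0; clear; lia.
  by congr (_%:R * _); move: c4 K0; clear; lia.
have b4 : 4 * h <= beta by rewrite betaE ler_pM2r// ler_nat; move: K0; clear; lia.
have := beta0; have := beta_pihalf; have := pi0; have := sb0; have := h0 => h_gt0 sb_gt0 pi_gt0 bp b_gt0.
have smono y z : - (pi / 2) <= y -> y <= z -> z <= pi / 2 -> sin y <= sin z.
  move=> y0 yz zb; rewrite ler_sin ?in_itv//=; apply/andP; split; lra.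
have Dle (c : nat) : (0 < c < 4)%N -> D (4 * K.-1 + c)%N <= (4 - c)%N%:R * h * sb.
  move=> c4; rewrite phiE; last by move: c4; clear; lia.
  set x := (4 - c)%N%:R * h.
  have xb : x <= beta.
    by apply: le_trans b4; rewrite ler_pM2r// ler_nat; move: c4; clear; lia.
  have x0 : 0 <= x by rewrite mulr_ge0 ?ler0n ?(ltW h0).
  have := cosBcos (beta - x / 2) (x / 2).
  rewrite (_ : beta - x / 2 - x / 2 = beta - x); last by field.
  rewrite subrK => ->.
  have s1 : sin (beta - x / 2) <= sb by apply: smono; lra.
  have s2 : sin (x / 2) <= x / 2 by apply: sin_le_id; lra.
  have s3 : 0 <= sin (x / 2) by apply: sin_ge0_pi; apply/andP; split; lra.
  move: s1 s2 s3; move: (sin (beta - x / 2)) (sin (x / 2)) => u v ? ? ?; nra.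
have D13 : sb * h / 2 <= D (4 * K.-1 + 1)%N - D (4 * K.-1 + 3)%N.
  rewrite !phiE// opprB addrA subrK -[(4 - 1)%N]/3%N -[(4 - 3)%N]/1%N.
  have := cosBcos (beta - 2 * h) h.
  rewrite (_ : beta - 2 * h - h = beta - 3%N%:R * h); last by ring.
  rewrite (_ : beta - 2 * h + h = beta - 1%N%:R * h); last by ring.
  move=> ->.
  have s1 : sin (beta / 2) <= sin (beta - 2 * h) by apply: smono; lra.
  have s2 : sb <= 2 * sin (beta / 2).
    rewrite {1}(_ : beta = (beta / 2) *+ 2); last by field.
    rewrite sin_mulr2n -mulr_natl ler_pM2l// ler_piMl ?cos_le1//.
    by apply: sin_ge0_pi; apply/andP; split; lra.
  have s3 : h / 2 <= sin h.
    by apply: sin_ge_half_id; apply/andP; split; lra.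
  move: s1 s2 s3; move: (sin (beta - 2 * h)) (sin (beta / 2)) (sin h) => u v w ? ? ?; nra.
have := Dle 1%N isT; have := Dle 3%N isT; rewrite -[(4 - 1)%N]/3%N -[(4 - 3)%N]/1%N.
have := amhm D1 D2 D3 (concaveD D2); move: D1 D3 D13.
move: (D (4 * K.-1 + 2)%N) => y.
move: (D (4 * K.-1 + 1)%N) (D (4 * K.-1 + 3)%N) => x z x0 z0 xz L zs xs; rewrite lerN2.
apply: (@le_trans _ _ (2 * sb * ((z - x) ^+ 2 / (x * z * (x + z))))); last first.
  by rewrite ler_pM2l// mulr_gt0.
have xz0 : 0 < x * z * (x + z) by rewrite !mulr_gt0 ?addr_gt0.
rewrite mulrA -[leLHS]mul1r ler_pdivlMr// mulrAC ler_pdivrMr ?mulr_gt0// mul1r.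
have xz1 : x * z <= 3 * h * sb * (1 * h * sb) by rewrite ler_pM// ltW.
have xz2 : x * z * (x + z) <= 3 * h * sb * (1 * h * sb) * (4 * h * sb).
  rewrite ler_pM ?mulr_ge0 ?addr_ge0 ?(ltW x0) ?(ltW z0)//; lra.
have xz3 : (sb * h / 2) ^+ 2 <= (z - x) ^+ 2.
  rewrite -[leRHS]sqrrN opprB ler_pXn2r// nnegrE; last by lra.
  by rewrite divr_ge0// mulr_ge0 ?ltW.
apply: (le_trans xz2).
apply: (@le_trans _ _ (2 * sb * (sb * h / 2) ^+ 2 * (36 * h))).
  rewrite -subr_ge0 (_ : _ - _ = 6 * (h * sb) ^+ 3); last by field.
  by rewrite mulr_ge0// exprn_ge0// mulr_ge0 ?ltW.
by rewrite ler_pM2r ?mulr_gt0// ler_pM2l// mulr_gt0.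
Qed.

(** Nothing cancels: all blocks are nonpositive, so the one at the kink suffices. *)
Let sum_psi : \sum_(i < n) sgn i * psi i <= - (36 * h)^-1.
Proof.
rewrite (_ : (16 * M)%N = (4 * (4 * M))%N); last by rewrite mulnA.
rewrite (sum_blocks4 _ (fun i => sgn i * psi i)).
have K1M : (K.-1 < 4 * M)%N by move: K0 KM; clear; lia.
rewrite (bigD1 (Ordinal K1M))//= -[X in _ <= X]addr0 lerD ?block_edge//.
by apply: sumr_le0 => b _; exact: block_le0.
Qed.

Let signal : \sum_(i < n) sgn i * (G i * Num.max (D i) 0) <= - (sb ^+ 2 / (36 * h)).
Proof.
rewrite (eq_bigr (fun i : 'I_n => sb ^+ 2 * (sgn i * psi i))) => [|i _].
  by rewrite -mulr_sumr -mulrN ler_pM2l ?exprn_gt0.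
rewrite /psi; case: ltP => D0; last by rewrite !mulr0.
by rewrite GMD; ring.
Qed.

Lemma extremal_pair : exists mu nu : 'I_n -> R,
  let x (i : 'I_n) := - cos (phi i) in
  [/\ forall i, 0 <= mu i, forall i, 0 <= nu i, \sum_i mu i = 1 & \sum_i nu i = 1] /\
  [/\ forall j, (j < 4 * M)%N -> \sum_i mu i * x i ^+ j = \sum_i nu i * x i ^+ j,
     \sum_i mu i * x i = - cb, \sum_i nu i * x i = - cb &
     \sum_i mu i * Num.max (- cb - x i) 0 + sb / (288 * pi * M%:R) <=
     \sum_i nu i * Num.max (- cb - x i) 0].
Proof.
have W0 : 0 < W by rewrite !mulr_gt0 ?exprn_gt0.
have sgn1 i : `|sgn i| <= 1 by rewrite /sgn normrX normrN normr1 expr1n.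
have mom0 j : (j < 4 * M)%N -> \sum_(i < n) sgn i * (G i * (- cos (phi i)) ^+ j) = 0.
  move=> jM; transitivity ((-1) ^+ j * \sum_(i < n) sgn i * (G i * cos (phi i) ^+ j)).
    rewrite mulr_sumr; apply: eq_bigr => i _; rewrite (exprNn (cos _)).
    by move: (sgn i) (G i) ((-1) ^+ j) (cos (phi i) ^+ j) => a b c d; ring.
  by rewrite moments// mulr0.
(* [e = 1] gives a law on the even nodes, [e = -1] one on the odd nodes; they differ by
   [2 sgn G / W]. *)
pose mu (e : R) (i : 'I_n) := (1 + e * sgn i) * G i / W.
have sum_mu e (f : nat -> R) : \sum_(i < n) mu e i * f i =
    (\sum_(i < n) G i * f i + e * \sum_(i < n) sgn i * (G i * f i)) / W.
  rewrite mulr_sumr -big_split/= mulr_suml; apply: eq_bigr => i _.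
  by rewrite /mu; field; rewrite gt_eqF.
have mu0 e i : `|e| <= 1 -> 0 <= mu e i.
  move=> e1; rewrite /mu divr_ge0 ?(ltW W0)// mulr_ge0//.
  have : `|e * sgn i| <= 1 by rewrite normrM mulr_ile1.
  by rewrite ler_norml => /andP[? _]; lra.
have M4 : (1 < 4 * M)%N by move: K0 KM; clear; lia.
have mu1 e : \sum_(i < n) mu e i = 1.
  under eq_bigr do rewrite -[mu _ _]mulr1.
  rewrite (sum_mu e (fun=> 1)); under eq_bigr do rewrite mulr1.
  rewrite sumG (_ : \sum_(i < n) sgn i * (G i * 1) = 0) ?mulr0 ?addr0 ?divff ?gt_eqF//.
  by rewrite -[RHS](mom0 0%N (ltnW M4)); apply: eq_bigr => i _; rewrite expr0.
have mux e : \sum_(i < n) mu e i * (- cos (phi i)) = - cb.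
  rewrite (sum_mu e (fun i => - cos (phi i))).
  rewrite (_ : \sum_(i < n) sgn i * (G i * - cos (phi i)) = 0); last first.
    by rewrite -[RHS](mom0 1%N M4); apply: eq_bigr => i _; rewrite expr1.
  under eq_bigr do rewrite mulrN.
  by rewrite sumrN sumGcos mulr0 addr0 mulNr mulrAC divff ?mul1r ?gt_eqF.
exists (mu 1), (mu (-1)) => /=; split.
  by split => // i; apply: mu0; rewrite ?normrN normr1.
split => // [j jM|].
  by rewrite !(sum_mu _ (fun i => (- cos (phi i)) ^+ j)) mom0// !mulr0.
have DE i : Num.max (- cb - - cos (phi i)) 0 = Num.max (D i) 0 by rewrite opprK addrC.
under eq_bigr do rewrite DE; under [leRHS]eq_bigr do rewrite DE.
rewrite !(sum_mu _ (fun i => Num.max (D i) 0)).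
have := signal; set S := \sum_(i < n) sgn i * _; set T := \sum_(i < n) _ => S0.
rewrite mul1r mulN1r -lerBrDl -mulrBl (_ : T - S - (T + S) = - S *+ 2); last by ring.
(* With [h = pi / (8 M)], [2 sb ^ 2 / (36 h W)] is [sb / (288 pi M)]. *)
rewrite ler_pdivlMr//; apply: (@le_trans _ _ (sb ^+ 2 / (36 * h) *+ 2)).
  rewrite /W -hM -subr_ge0 (_ : _ - _ = 0)//; field.
  by rewrite !gt_eqF.
by rewrite lerMn2r/= -lerNr.
Qed.

End extremal_pair.

(** * Poisson vectors with shifted rates *)

Section poisson_vectors.
Context {R : realType}.

Definition poisson_mass (lambda : R) (k : nat) : R :=
  fine (poisson_prob lambda 0 [set k]).

Lemma poisson_massE (lambda : R) k : 0 <= lambda ->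
  poisson_mass lambda k = lambda ^+ k / k`!%:R * expR (- lambda).
Proof.
rewrite /poisson_mass /poisson_prob le_eqVlt => /orP[/eqP<-|l0].
  rewrite ltxx oppr0 expR0 mulr1 /dirac indicE/= expr0n.
  have [->|k0] := eqVneq k 0%N; first by rewrite mem_set// fact0 divr1.
  by rewrite memNset ?mul0r//= => k0'; rewrite -k0' eqxx in k0.
by rewrite l0 esum_set1 ?lee_fin ?poisson_pmf_ge0//= /poisson_pmf l0.
Qed.

Definition vector_mass S n (Q : S.-tuple R) (k : S.-tuple nat) : R :=
  \prod_(i < S) poisson_mass (n%:R * tnth Q i) (tnth k i).

Lemma vector_mass_ge0 S n (Q : S.-tuple R) k : 0 <= vector_mass n Q k.
Proof. by apply: prodr_ge0 => i _; exact: fine_ge0. Qed.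

Lemma poisson_sampleE S n (Q : S.-tuple R) (E : set (S.-tuple nat)) :
  poisson_sample n Q E = (\esum_(k in E) (vector_mass n Q k)%:E)%E.
Proof. by []. Qed.

Definition prob S n (Q : S.-tuple R) (E : set (S.-tuple nat)) : R :=
  fine (poisson_sample n Q E).

Lemma probE S n (Q : S.-tuple R) E : (prob n Q E)%:E = poisson_sample n Q E.
Proof.
rewrite fineK// ge0_fin_numE ?esum_ge0//; last first.
  by move=> k _; rewrite lee_fin vector_mass_ge0.
rewrite (@le_lt_trans _ _ 1%E) ?ltry//.
rewrite -(@probability_setT _ _ _ (poisson_sample n Q)) !poisson_sampleE.
rewrite esum_mkcond; apply: le_esum => k _; case: ifP => // _.
by rewrite lee_fin vector_mass_ge0.
Qed.

Lemma prob_setT S n (Q : S.-tuple R) : prob n Q setT = 1.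
Proof. by rewrite /prob probability_setT. Qed.

Lemma prob_ge0 S n (Q : S.-tuple R) E : 0 <= prob n Q E.
Proof. exact: fine_ge0. Qed.

Lemma probC S n (Q : S.-tuple R) E : prob n Q E + prob n Q (~` E) = 1.
Proof.
apply: EFin_inj; rewrite EFinD !probE !poisson_sampleE.
rewrite -(@prob_setT S n Q) probE poisson_sampleE.
rewrite [RHS](esumID E) ?setTI// => k _; by rewrite lee_fin vector_mass_ge0.
Qed.

Lemma prob_le1 S n (Q : S.-tuple R) E : prob n Q E <= 1.
Proof. by rewrite -(probC n Q E) lerDl prob_ge0. Qed.

(** Infinite sums are available for nonnegative terms only, so the signed coefficients are split
    into positive and negative parts before summing over [E]. *)
Lemma sum_prob_ge0 S n (T : finType) (c : T -> R) (Q : T -> S.-tuple R) E :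
  (forall k, 0 <= \sum_t c t * vector_mass n (Q t) k) ->
  0 <= \sum_t c t * prob n (Q t) E.
Proof.
move=> H; pose cp t := Num.max (c t) 0; pose cn t := Num.max (- c t) 0.
have cpn t : c t = cp t - cn t.
  by rewrite /cp /cn; case: leP => h; case: leP => h'; lra.
have cp0 t : 0 <= cp t by rewrite le_max lexx orbT.
have cn0 t : 0 <= cn t by rewrite le_max lexx orbT.
have split (f : T -> R) : \sum_t c t * f t = \sum_t cp t * f t - \sum_t cn t * f t.
  by rewrite -sumrB; apply: eq_bigr => t _; rewrite cpn mulrBl.
have esumE (d : T -> R) : (forall t, 0 <= d t) ->
   ((\sum_t d t * prob n (Q t) E)%:E = \esum_(k in E) (\sum_t d t * vector_mass n (Q t) k)%:E)%E.
  move=> d0; under eq_esum do rewrite -sumEFin.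
  rewrite esum_sum; last by move=> k t _ _; rewrite lee_fin mulr_ge0// vector_mass_ge0.
  rewrite -sumEFin; apply: eq_bigr => t _; rewrite EFinM probE poisson_sampleE.
  under [RHS]eq_esum do rewrite EFinM.
  by rewrite esumZl// => k; rewrite lee_fin vector_mass_ge0.
rewrite split subr_ge0 -lee_fin !esumE//; apply: le_esum => k _.
by rewrite lee_fin -subr_ge0 -split.
Qed.

End poisson_vectors.

(** * Exponential quadratic forms under vanishing moments *)

Section exponential_moments.
Context {R : realType}.

Lemma sum_exp_coeff_le (z : R) M : 0 <= z ->
  \sum_(l < M) z ^+ l / l`!%:R <= expR z.
Proof.
move=> z0; rewrite -(big_mkord xpredT (fun l => z ^+ l / l`!%:R)).
apply: (@nondecreasing_cvgn_le R (series (exp_coeff z))); last exact: is_cvg_series_exp_coeff.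
by apply: nondecreasing_series => l _ _; exact: exp_coeff_ge0.
Qed.

(* For [theta >= 1] the terms of order at least [k] of [exp r] are at most
   [theta ^- k] times those of [exp (theta r)]. *)
Lemma exp_form_le (T : finType) (sigma x : T -> R) (theta r : R) k :
  1 <= theta -> 0 <= r -> (forall i, `|x i| <= 1) -> \sum_i `|sigma i| <= 2 ->
  (forall j, (j < k)%N -> \sum_i sigma i * x i ^+ j = 0) ->
  \sum_i \sum_j sigma i * sigma j * expR (r * x i * x j) <=
  4 * theta ^- k * expR (theta * r).
Proof.
move=> t1 r0 x1 s2 mom.
have t0 : 0 < theta by apply: lt_le_trans t1.
pose u M := \sum_i \sum_j sigma i * sigma j * \sum_(0 <= l < M) (r * x i * x j) ^+ l / l`!%:R.
have cu : u @ \oo --> \sum_i \sum_j sigma i * sigma j * expR (r * x i * x j).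
  apply: cvg_big => [|i _]; first by move=> ?; apply: add_continuous.
  apply: cvg_big => [|j _]; first by move=> ?; apply: add_continuous.
  by apply: cvgMl_tmp; exact: is_cvg_series_exp_coeff.
apply: cvgr_to_le cu _; near=> M; rewrite /u.
(* The Taylor term of order [l] is a multiple of the square of the [l]-th moment of [sigma]: it
   vanishes below order [k], and every moment is at most 2 in modulus. *)
have -> : \sum_i \sum_j sigma i * sigma j * \sum_(0 <= l < M) (r * x i * x j) ^+ l / l`!%:R =
   \sum_(l < M) r ^+ l / l`!%:R * (\sum_i sigma i * x i ^+ l) ^+ 2.
  under eq_bigr do under eq_bigr do rewrite big_mkord mulr_sumr.
  under eq_bigr do rewrite exchange_big.
  rewrite exchange_big; apply: eq_bigr => l _.
  rewrite expr2 mulr_suml mulr_sumr; apply: eq_bigr => i _.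
  rewrite !mulr_sumr; apply: eq_bigr => j _.
  by rewrite !exprMn; ring.
apply: (@le_trans _ _ (\sum_(l < M) 4 * theta ^- k * ((theta * r) ^+ l / l`!%:R))); last first.
  rewrite -mulr_sumr ler_wpM2l ?sum_exp_coeff_le ?mulr_ge0 ?invr_ge0 ?exprn_ge0 ?(ltW t0)//.
apply: ler_sum => l _; have [lk|kl] := ltnP l k.
  rewrite mom// expr0n mulr0 !mulr_ge0 ?invr_ge0 ?exprn_ge0 ?mulr_ge0 ?(ltW t0)//.
have s4 : (\sum_i sigma i * x i ^+ l) ^+ 2 <= 4.
  rewrite -[leLHS]ger0_norm ?sqr_ge0// normrX (_ : 4 = 2 ^+ 2); last by ring.
  rewrite ler_pXn2r ?nnegrE//; apply: le_trans s2; apply: (le_trans (ler_norm_sum _ _ _)).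
  by apply: ler_sum => i _; rewrite normrM ler_piMr// normrX exprn_ile1.
have -> : 4 * theta ^- k * ((theta * r) ^+ l / l`!%:R) = theta ^+ (l - k) * (r ^+ l / l`!%:R * 4).
  rewrite exprMn -[in theta ^+ l](subnK kl) exprD; field.
  by rewrite expf_neq0 ?gt_eqF// pnatr_eq0 -lt0n fact_gt0.
have r'0 : 0 <= r ^+ l / l`!%:R by rewrite divr_ge0// exprn_ge0.
rewrite -[leLHS]mul1r; apply: ler_pM => //; last exact: ler_wpM2l.
  by rewrite mulr_ge0// sqr_ge0.
exact: exprn_ege1.
Unshelve. all: by end_near. Qed.

End exponential_moments.

Lemma sum_ord2_recl {R : realType} N (f : 'I_N.+1 -> 'I_N.+1 -> R) :
  \sum_i \sum_j f i j = f ord0 ord0 + \sum_(i < N) f ord0 (lift ord0 i) +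
    \sum_(i < N) f (lift ord0 i) ord0 + \sum_(i < N) \sum_(j < N) f (lift ord0 i) (lift ord0 j).
Proof.
rewrite big_ord_recl [in X in X + _ = _]big_ord_recl -!addrA; congr (_ + (_ + _)).
by rewrite -big_split/=; apply: eq_bigr => i _; rewrite big_ord_recl.
Qed.

Lemma quadratic_le {R : realType} (eta Z p v : R) : 0 < eta -> Z <= eta ^+ 2 -> p <= 1 ->
  0 <= eta * eta * p + - eta * v + - eta * v + Z -> v <= eta.
Proof.
rewrite expr2 => eta0 Z1 p1 Z2; rewrite -(ler_pM2l eta0).
have : eta * eta * p <= eta * eta * 1 by rewrite ler_pM2l ?mulr_gt0.
lra.
Qed.

Section shift.
Context {R : realType} (S n : nat) (s m : 'I_S) (a b : R) (q0 : 'I_S -> R).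

(* Up to an exponential factor, the product of the likelihood ratios of
   [shifted u 0] and [shifted v 0] relative to [shifted 0 0] is the likelihood
   ratio of [shifted u v]; hence the quadratic form below is nonnegative. *)
Definition shifted (u v : R) : S.-tuple R :=
  [tuple if l == s then (a + u) * (a + v) / a
         else if l == m then (b - u) * (b - v) / b else q0 l | l < S].

Hypotheses (sm : m != s) (a0 : 0 < a) (b0 : 0 < b).

Let L u (k : S.-tuple nat) := (1 + u / a) ^+ tnth k s * (1 - u / b) ^+ tnth k m.

Lemma shiftedC u v : shifted u v = shifted v u.
Proof.
apply: eq_from_tnth => l; rewrite !tnth_mktuple.
by rewrite [(a + u) * _]mulrC [(b - u) * _]mulrC.
Qed.

(** What [s] gains [m] loses, so the terms linear in [u] and [v] cancel in the total rate and only
    [u v (1 / a + 1 / b)] is left in the exponent. *)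
Lemma shifted_mass u v k : - a <= u <= b -> - a <= v <= b ->
  expR (n%:R * u * v * (a^-1 + b^-1)) * vector_mass n (shifted u v) k =
  vector_mass n (shifted 0 0) k * (L u k * L v k).
Proof.
move=> /andP[ua ub] /andP[va vb]; rewrite /vector_mass.
rewrite (bigD1 s isT)/= (bigD1 m)/=; last by rewrite sm.
rewrite [in RHS](bigD1 s isT)/= [in RHS](bigD1 m)/=; last by rewrite sm.
set p := \prod_(i < S | _) _; set p' := \prod_(i < S | _) _.
have -> : p = p'.
  apply: eq_bigr => i /andP[is_ im]; rewrite !tnth_mktuple (negPf is_) (negPf im)//.
rewrite !tnth_mktuple !eqxx (negPf sm) !addr0 !subr0.
have a_ge0 := ltW a0; have b_ge0 := ltW b0.
have au : 0 <= a + u by rewrite -lerBlDl sub0r.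
have av : 0 <= a + v by rewrite -lerBlDl sub0r.
have bu : 0 <= b - u by rewrite subr_ge0.
have bv : 0 <= b - v by rewrite subr_ge0.
have rate (x y z : R) : 0 <= x -> 0 <= y -> 0 <= z -> 0 <= n%:R * (x * y / z).
  by move=> *; rewrite mulr_ge0// divr_ge0// mulr_ge0.
rewrite !poisson_massE; try exact: rate.
set i := tnth k s; set j := tnth k m.
have E : expR (n%:R * u * v * (a^-1 + b^-1)) * (expR (- (n%:R * ((a + u) * (a + v) / a)))
     * expR (- (n%:R * ((b - u) * (b - v) / b)))) =
     expR (- (n%:R * (a * a / a))) * expR (- (n%:R * (b * b / b))).
  by rewrite -!expRD; congr expR; field; rewrite !gt_eqF.
rewrite [LHS](_ : _ = (n%:R * ((a + u) * (a + v) / a)) ^+ i * (n%:R * ((b - u) * (b - v) / b)) ^+ j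
   / i`!%:R / j`!%:R * p' * (expR (n%:R * u * v * (a^-1 + b^-1)) * (expR (- (n%:R * ((a + u) * (a + v) / a)))
     * expR (- (n%:R * ((b - u) * (b - v) / b)))))); last by ring.
rewrite E /L -/i -/j.
have -> : n%:R * ((a + u) * (a + v) / a) = n%:R * (a * a / a) * ((1 + u / a) * (1 + v / a)).
  by field; rewrite gt_eqF.
have -> : n%:R * ((b - u) * (b - v) / b) = n%:R * (b * b / b) * ((1 - u / b) * (1 - v / b)).
  by field; rewrite gt_eqF.
rewrite !exprMn; ring.
Qed.

(** At each sample the form is a mass times the square of [sum_t tau t * L (u t)]. *)
Lemma shifted_form_ge0 (T : finType) (tau u : T -> R) E :
  (forall t, - a <= u t <= b) ->
  0 <= \sum_t \sum_t' tau t * tau t' *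
     expR (n%:R * u t * u t' * (a^-1 + b^-1)) * prob n (shifted (u t) (u t')) E.
Proof.
move=> uab; rewrite pair_bigA/=.
apply: (@sum_prob_ge0 R S n _ (fun p => tau p.1 * tau p.2 *
     expR (n%:R * u p.1 * u p.2 * (a^-1 + b^-1))) (fun p => shifted (u p.1) (u p.2))) => k.
rewrite [leRHS](_ : _ = vector_mass n (shifted 0 0) k * (\sum_t tau t * L (u t) k) ^+ 2).
  by rewrite mulr_ge0 ?vector_mass_ge0 ?sqr_ge0.
rewrite expr2 mulr_suml mulr_sumr -(pair_bigA _ (fun t t' => tau t * tau t' *
     expR (n%:R * u t * u t' * (a^-1 + b^-1)) * vector_mass n (shifted (u t) (u t')) k))/=.
apply: eq_bigr => t _; rewrite !mulr_sumr; apply: eq_bigr => t' _.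
by rewrite -[LHS]mulrA shifted_mass//; ring.
Qed.

(** Nonnegativity on the complement of [E] bounds the form on [E] by the form on the whole space, at
    most [eta ^ 2] by [exp_form_le]. One extra point of weight [eta] at shift zero, and [- sigma]
    elsewhere, then gives [2 eta V <= eta ^ 2 p + eta ^ 2], with [V] the sum to bound and [p <= 1]:
    Cauchy-Schwarz in polarised form. *)
Lemma shift_tv N (sigma x : 'I_N -> R) (w theta eta : R) k E :
  0 <= w -> w <= a -> w <= b -> (forall i, `|x i| <= 1) -> \sum_i `|sigma i| <= 2 ->
  (forall j, (j < k)%N -> \sum_i sigma i * x i ^+ j = 0) ->
  1 <= theta -> 0 < eta ->
  4 * theta ^- k * expR (theta * (n%:R * w ^+ 2 * (a^-1 + b^-1))) <= eta ^+ 2 ->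
  \sum_i sigma i * prob n (shifted (w * x i) 0) E <= eta.
Proof.
move=> w0 wa wb x1 s2 mom t1 eta0 chi.
have wx (y : R) : `|y| <= 1 -> - a <= w * y <= b.
  rewrite ler_norml => /andP[y1 y2]; apply/andP; split; nra.
pose e i j := expR (n%:R * (w * x i) * (w * x j) * (a^-1 + b^-1)).
pose P i j F := prob n (shifted (w * x i) (w * x j)) F.
have formC : 0 <= \sum_i \sum_j sigma i * sigma j * e i j * P i j (~` E).
  by apply: (@shifted_form_ge0 _ sigma (fun i => w * x i)) => i; exact: wx.
have form1 : \sum_i \sum_j sigma i * sigma j * e i j <= eta ^+ 2.
  apply: le_trans chi; apply: le_trans (@exp_form_le R _ sigma x theta _ k _ _ _ _ _) => //.
    rewrite le_eqVlt; apply/orP; left; apply/eqP.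
    apply: eq_bigr => i _; apply: eq_bigr => j _; rewrite /e.
    by congr (_ * expR _); ring.
  by rewrite !mulr_ge0 ?sqr_ge0// addr_ge0// invr_ge0 ltW.
have form2 : \sum_i \sum_j sigma i * sigma j * e i j * P i j E <= eta ^+ 2.
  apply: le_trans form1; rewrite -subr_ge0; move: formC; congr (0 <= _).
  rewrite -sumrB; apply: eq_bigr => i _; rewrite -sumrB; apply: eq_bigr => j _.
  by rewrite -[X in X - _]mulr1 -(probC n (shifted (w * x i) (w * x j)) E) /P; ring.
pose tau (t : 'I_N.+1) := if unlift ord0 t is Some i then - sigma i else eta.
pose u (t : 'I_N.+1) := if unlift ord0 t is Some i then w * x i else 0.
have uab t : - a <= u t <= b.
  rewrite /u; case: unliftP => [i _|_]; first exact: wx.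
  by rewrite oppr_le0 !ltW.
have tau0 : tau ord0 = eta by rewrite /tau unlift_none.
have tauS i : tau (lift ord0 i) = - sigma i by rewrite /tau liftK.
have u0 : u ord0 = 0 by rewrite /u unlift_none.
have uS i : u (lift ord0 i) = w * x i by rewrite /u liftK.
have G := shifted_form_ge0 tau E uab; move: tau u tau0 tauS u0 uS G {uab} => tau u tau0 tauS u0 uS G.
pose f t t' := tau t * tau t' * expR (n%:R * u t * u t' * (a^-1 + b^-1)) * prob n (shifted (u t) (u t')) E.
pose V := \sum_i sigma i * prob n (shifted (w * x i) 0) E.
have f00 : f ord0 ord0 = eta * eta * prob n (shifted 0 0) E.
  by rewrite /f tau0 u0 !mulr0 mul0r expR0 mulr1.
have AE : \sum_(i < N) f ord0 (lift ord0 i) = - eta * V.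
  rewrite /V mulr_sumr; apply: eq_bigr => i _.
  by rewrite /f tau0 tauS u0 uS shiftedC mulr0 !mul0r expR0 mulr1; ring.
have BE : \sum_(i < N) f (lift ord0 i) ord0 = - eta * V.
  rewrite /V mulr_sumr; apply: eq_bigr => i _.
  by rewrite /f tau0 tauS u0 uS mulr0 mul0r expR0 mulr1; ring.
have fS t t' i j : tau t = - sigma i -> tau t' = - sigma j -> u t = w * x i ->
    u t' = w * x j -> f t t' = sigma i * sigma j * e i j * P i j E.
  rewrite /f /e /P.
  move=> Et Et' Eu Eu'.
  rewrite Et Et' Eu Eu'.
  congr (_ * _ * _).
  exact: mulrNN.
have fE : \sum_(i < N) \sum_(j < N) f (lift ord0 i) (lift ord0 j) =
    \sum_i \sum_j sigma i * sigma j * e i j * P i j E.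
  apply: eq_bigr => i _; apply: eq_bigr => j _; refine (fS _ _ i j (tauS i) (tauS j) (uS i) (uS j)).
have G1 : 0 <= f ord0 ord0 + \sum_(i < N) f ord0 (lift ord0 i) +
    \sum_(i < N) f (lift ord0 i) ord0 + \sum_(i < N) \sum_(j < N) f (lift ord0 i) (lift ord0 j).
  rewrite -(sum_ord2_recl f); exact G.
have G0 : 0 <= eta * eta * prob n (shifted 0 0) E + - eta * V + - eta * V +
   \sum_i \sum_j sigma i * sigma j * e i j * P i j E.
  by rewrite -f00 -[X in _ + X + _ + _]AE -[X in _ + _ + X + _]BE -fE.
have p1 := prob_le1 n (shifted 0 0) E.
exact (quadratic_le eta0 form2 p1 G0).
Qed.

End shift.

(** * Product priors *)

Section product_weights.
Context {R : realType} (S : nat) (T : finType).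
Implicit Types (mu nu w : 'I_S -> T -> R) (u : {ffun 'I_S -> T}).

Definition is_weight w := forall i, (forall t, 0 <= w i t) /\ \sum_t w i t = 1.

Definition expect w (phi : {ffun 'I_S -> T} -> R) : R :=
  \sum_(u : {ffun 'I_S -> T}) (\prod_i w i (u i)) * phi u.

Definition update u (i : 'I_S) (t : T) : {ffun 'I_S -> T} :=
  [ffun j => if j == i then t else u j].

Lemma expect_prod w (g : 'I_S -> T -> R) :
  expect w (fun u => \prod_i g i (u i)) = \prod_i \sum_t w i t * g i t.
Proof.
rewrite bigA_distr_bigA/=; apply: eq_bigr => u _.
by rewrite -big_split.
Qed.

Lemma expect_eq w (f g : {ffun 'I_S -> T} -> R) : f =1 g -> expect w f = expect w g.
Proof. by move=> fg; apply: eq_bigr => u _; rewrite fg. Qed.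

Lemma expectD w f g : expect w (fun u => f u + g u) = expect w f + expect w g.
Proof. by rewrite -big_split; apply: eq_bigr => u _; rewrite mulrDr. Qed.

Lemma expectZ w c f : expect w (fun u => c * f u) = c * expect w f.
Proof. by rewrite mulr_sumr; apply: eq_bigr => u _; rewrite mulrCA. Qed.

Lemma expect_sum w (J : finType) (f : J -> {ffun 'I_S -> T} -> R) :
  expect w (fun u => \sum_j f j u) = \sum_j expect w (f j).
Proof. by rewrite exchange_big; apply: eq_bigr => u _; rewrite mulr_sumr. Qed.

Section probability_weights.
Variable w : 'I_S -> T -> R.
Hypothesis hw : is_weight w.

Lemma expect_le f g : (forall u, f u <= g u) -> expect w f <= expect w g.
Proof.
move=> fg; apply: ler_sum => u _; apply: ler_wpM2l; last exact: fg.
by apply: prodr_ge0 => i _; exact: (hw i).1.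
Qed.

Lemma expect1 : expect w (fun=> 1) = 1.
Proof.
transitivity (expect w (fun u => \prod_(i < S) 1)); first by apply: expect_eq => u; rewrite big1.
rewrite (expect_prod w (fun _ _ => 1)) big1// => i _.
by under eq_bigr do rewrite mulr1; exact: (hw i).2.
Qed.

Lemma expect_cst c : expect w (fun=> c) = c.
Proof.
transitivity (expect w (fun=> c * 1)); first by apply: expect_eq => u; rewrite mulr1.
by rewrite expectZ expect1 mulr1.
Qed.

Lemma expect_coord i (g : T -> R) : expect w (fun u => g (u i)) = \sum_t w i t * g t.
Proof.
pose g' j t := if j == i then g t else 1.
transitivity (expect w (fun u => \prod_j g' j (u j))).
  apply: expect_eq => u; rewrite (bigD1 i)//= /g' eqxx big1 ?mulr1// => j ji.
  by rewrite (negPf ji).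
rewrite expect_prod (bigD1 i)//= /g' eqxx [X in _ * X]big1 ?mulr1// => j /negPf ->.
by under eq_bigr do rewrite mulr1; exact: (hw j).2.
Qed.

Lemma expect_coord2 i j (g h : T -> R) : i != j ->
  expect w (fun u => g (u i) * h (u j)) = (\sum_t w i t * g t) * (\sum_t w j t * h t).
Proof.
move=> ij; pose g' k t := if k == i then g t else if k == j then h t else 1.
transitivity (expect w (fun u => \prod_k g' k (u k))).
  apply: expect_eq => u; rewrite (bigD1 i)//= (bigD1 j) 1?eq_sym//= /g' !eqxx.
  rewrite eq_sym (negPf ij) [X in _ * (_ * X)]big1 ?mulr1// => k /andP[ki kj].
  by rewrite (negPf ki) (negPf kj).
rewrite expect_prod (bigD1 i)//= (bigD1 j) 1?eq_sym//= /g' !eqxx.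
rewrite eq_sym (negPf ij) [X in _ * (_ * X)]big1 ?mulr1// => k /andP[/negPf -> /negPf ->].
by under eq_bigr do rewrite mulr1; exact: (hw k).2.
Qed.

Lemma expect_sum_sqr (g : 'I_S -> T -> R) : (forall i, \sum_t w i t * g i t = 0) ->
  expect w (fun u => (\sum_i g i (u i)) ^+ 2) = \sum_i \sum_t w i t * g i t ^+ 2.
Proof.
move=> g0.
transitivity (expect w (fun u => \sum_i \sum_j g i (u i) * g j (u j))).
  apply: expect_eq => u; rewrite expr2 mulr_suml; apply: eq_bigr => i _.
  by rewrite mulr_sumr.
rewrite expect_sum; apply: eq_bigr => i _; rewrite expect_sum (bigD1 i)//=.
rewrite big1 ?addr0 => [|j ji]; last by rewrite expect_coord2 1?eq_sym// g0 mul0r.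
by rewrite -expect_coord; apply: expect_eq => u; rewrite expr2.
Qed.

Lemma markov_expect (f : {ffun 'I_S -> T} -> R) (c : R) : 0 < c -> (forall u, 0 <= f u) ->
  expect w (fun u => (c < f u)%R%:R) <= expect w f / c.
Proof.
move=> c0 f0; rewrite mulrC -expectZ; apply: expect_le => u.
case: ltP => cf; last by rewrite mulr_ge0// invr_ge0 ltW.
by rewrite ler_pdivlMl// mulr1 ltW.
Qed.

Lemma chebyshev_expect (g : 'I_S -> T -> R) (c : R) : 0 < c ->
  expect w (fun u => (c < `|\sum_i g i (u i) - \sum_i \sum_t w i t * g i t|)%R%:R) <=
  (\sum_i \sum_t w i t * (g i t - \sum_t' w i t' * g i t') ^+ 2) / c ^+ 2.
Proof.
move=> c0; pose m i := \sum_t' w i t' * g i t'.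
rewrite -(@expect_sum_sqr (fun i t => g i t - m i)) => [|i]; last first.
  under eq_bigr do rewrite mulrBr.
  by rewrite sumrB -mulr_suml (hw i).2 mul1r subrr.
have c2 : 0 < c ^+ 2 by rewrite exprn_gt0.
apply: le_trans (markov_expect c2 (fun u => sqr_ge0 _)).
apply: expect_le => u; case: (ltP c) => h; last exact: ler0n.
rewrite (_ : c ^+ 2 < _ = true)//.
rewrite sumrB -[X in _ < X]ger0_norm ?sqr_ge0// normrX.
by rewrite ltr_pXn2r ?nnegrE// ltW.
Qed.

(* Exchanging [u i] with the fresh value [t] is an involution on pairs. *)
Lemma expect_resample i (d : T -> R) (phi : {ffun 'I_S -> T} -> R) :
  \sum_(u : {ffun 'I_S -> T}) (\prod_(j | j != i) w j (u j)) * d (u i) * phi u =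
  expect w (fun u => \sum_t d t * phi (update u i t)).
Proof.
rewrite /expect; under [RHS]eq_bigr do rewrite mulr_sumr.
rewrite pair_bigA/= (reindex_inj (h := fun p => (update p.1 i p.2, p.1 i)))/=; last first.
  apply: (can_inj (g := fun p => (update p.1 i p.2, p.1 i))) => -[u t]/=; congr (_, _).
    by apply/ffunP => j; rewrite !ffunE; case: eqP => [->|].
  by rewrite ffunE eqxx.
rewrite -(pair_bigA _ (fun u t => (\prod_j w j (update u i t j)) * (d (u i) * phi (update (update u i t) i (u i)))))/=.
apply: eq_bigr => u _; rewrite -[LHS]mul1r -(hw i).2 mulr_suml; apply: eq_bigr => t _.
rewrite [in RHS](bigD1 i isT)/= ffunE eqxx; have -> : update (update u i t) i (u i) = u.
  by apply/ffunP => j; rewrite !ffunE; case: eqP => [->|].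
rewrite !mulrA; congr (_ * _ * _ * _); apply: eq_bigr => j ji.
by rewrite ffunE (negPf ji).
Qed.

End probability_weights.

Definition hybrid mu nu (s : nat) : 'I_S -> T -> R :=
  fun i => if (i < s)%N then nu i else mu i.

Lemma hybrid_weight mu nu s : is_weight mu -> is_weight nu -> is_weight (hybrid mu nu s).
Proof. by move=> hmu hnu i; rewrite /hybrid; case: ifP => _; [exact: hnu|exact: hmu]. Qed.

(** Each term of the telescope changes the law of one coordinate. Writing it by resampling lets all
    other coordinates be frozen, as the comparison of a single coordinate requires. *)
Lemma expect_hybrid mu nu (phi : {ffun 'I_S -> T} -> R) : is_weight mu -> is_weight nu ->
  expect nu phi - expect mu phi =
  \sum_(s < S) expect (hybrid mu nu s)
     (fun u => \sum_t (nu s t - mu s t) * phi (update u s t)).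
Proof.
move=> hmu hnu; pose f s := expect (hybrid mu nu s) phi.
have -> : expect nu phi = f S.
  by apply: eq_bigr => u _; congr (_ * _); apply: eq_bigr => i _; rewrite /hybrid ltn_ord.
have -> : expect mu phi = f 0%N.
  by apply: eq_bigr => u _; congr (_ * _); apply: eq_bigr => i _; rewrite /hybrid ltn0.
rewrite -(telescope_sumr f (leq0n S)) big_mkord; apply: eq_bigr => s _.
rewrite -(expect_resample (hybrid_weight s hmu hnu)) /f /expect -sumrB.
apply: eq_bigr => u _; rewrite (bigD1 s)//= [X in _ - X * _](bigD1 s)//=.
rewrite {1 3}/hybrid ltnSn ltnn.
have -> : \prod_(i < S | i != s) hybrid mu nu s.+1 i (u i) = \prod_(i < S | i != s) hybrid mu nu s i (u i).
  apply: eq_bigr => i is_; rewrite /hybrid ltnS leq_eqVlt.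
  by rewrite (_ : (i == s :> nat) = false)//; exact: negPf.
ring.
Qed.

End product_weights.

(** * Splitting an index set into lighter halves *)

Lemma split_seq {R : realType} (T : eqType) (l : seq T) (p : T -> R) (c : R) :
  (forall i, 0 <= p i) -> 0 <= c -> c < \sum_(i <- l) p i ->
  exists l1 x l2, [/\ l = l1 ++ x :: l2, \sum_(i <- l1) p i <= c &
    c < \sum_(i <- l1) p i + p x].
Proof.
move=> p0; elim: l c => [|y l IH] c c0; first by rewrite big_nil ltNge c0.
rewrite big_cons => cl; have [cy|yc] := ltP c (p y).
  by exists [::], y, l; rewrite big_nil add0r.
have [||l1 [x [l2 [-> l1c cl1]]]] := IH (c - p y); rewrite ?subr_ge0 ?ltrBlDl//.
exists (y :: l1), x, l2; rewrite big_cons; split => //; first by rewrite -lerBrDl.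
by rewrite -addrA -ltrBlDl.
Qed.

(** The mass of [p] crosses its half at one index, and the indices before it and after it both weigh
    at most half. The side richer in [r] is kept; the crossing index, worth at most [rho], is the
    excluded [m]. *)
Lemma split_half {R : realType} (S : nat) (A : {set 'I_S}) (p r : 'I_S -> R) (rho : R) :
  (forall i, 0 <= p i) -> (forall i, 0 <= r i <= rho) -> 0 < \sum_(i in A) p i ->
  exists2 B : {set 'I_S}, B \subset A &
   (exists2 m, m \in A & m \notin B) /\
   (\sum_(i in B) p i <= (\sum_(i in A) p i) / 2 /\ \sum_(i in A) r i <= 2 * (\sum_(i in B) r i) + rho).
Proof.
move=> p0 r0 pA; set c := \sum_(i in A) p i.
have uA : uniq (enum A) by exact: enum_uniq.
have c0 : 0 <= c / 2 by rewrite divr_ge0// ltW.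
have cA : c / 2 < \sum_(i <- enum A) p i by rewrite big_enum/= -/c; rewrite -/c in pA; lra.
have [l1 [x [l2 [eA l1c cl1]]]] := split_seq p0 c0 cA.
have bigA (f : 'I_S -> R) : \sum_(i in A) f i = \sum_(i <- l1) f i + f x + \sum_(i <- l2) f i.
  by rewrite -big_enum/= eA big_cat big_cons/= addrA.
have bigB (l : seq 'I_S) (f : 'I_S -> R) : uniq l -> \sum_(i in [set i in l]) f i = \sum_(i <- l) f i.
  move=> ul; rewrite big_uniq//; apply: eq_bigl => i; by rewrite inE.
move: uA; rewrite eA cat_uniq/= => /and4P[u1 h12 x2 u2].
have memA i : i \in l1 ++ x :: l2 -> i \in A by rewrite -eA mem_enum.
have xA : x \in A by apply: memA; rewrite mem_cat inE eqxx orbT.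
have cE : c = \sum_(i <- l1) p i + p x + \sum_(i <- l2) p i by rewrite /c bigA.
have := bigA r; have /andP[_ rx] := r0 x.
have x1 : x \notin l1 by apply: contra h12 => xl1; apply/orP; left.
have [r12|r12] := leP (\sum_(i <- l2) r i) (\sum_(i <- l1) r i) => rE.
  exists [set i in l1].
    by apply/fintype.subsetP => i; rewrite inE => il1; apply: memA; rewrite mem_cat il1.
  split; first by exists x; rewrite ?inE.
  rewrite !bigB//; split => //; lra.
exists [set i in l2].
  by apply/fintype.subsetP => i; rewrite inE => il2; apply: memA; rewrite mem_cat inE il2 !orbT.
split; first by exists x; rewrite ?inE.
rewrite !bigB//; split; lra.
Qed.

(** The losses double with each round, so [2 ^ J rho] covers their sum. A set without mass cannot be
    split and is kept. *)
Lemma split_iter {R : realType} (S : nat) (A : {set 'I_S}) (p r : 'I_S -> R) (rho : R) J :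
  (forall i, 0 <= p i) -> 0 <= rho -> (forall i, 0 <= r i <= rho) ->
  exists2 B : {set 'I_S}, B \subset A &
   2 ^+ J * \sum_(i in B) p i <= \sum_(i in A) p i /\
   \sum_(i in A) r i <= 2 ^+ J * (\sum_(i in B) r i + rho).
Proof.
move=> p0 rho0 r0.
elim: J => [|J [B BA [pB rB]]].
  by exists A => //; rewrite expr0 !mul1r lerDl.
have J0 : 0 < 2 ^+ J :> R by rewrite exprn_gt0.
have : 0 <= \sum_(i in B) p i by apply: sumr_ge0.
rewrite le_eqVlt => /orP[/eqP pB0|pB0].
  exists B => //; rewrite -pB0 mulr0; split; first exact: sumr_ge0.
  apply: le_trans rB _; rewrite exprS ler_wpM2r//; last lra.
  by rewrite addr_ge0// sumr_ge0// => i _; have /andP[] := r0 i.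
have [D DB [_ [pD rD]]] := split_half p0 r0 pB0.
exists D; first exact: fintype.subset_trans DB BA.
rewrite exprS; split.
  apply: le_trans pB; rewrite mulrAC mulrC ler_pM2l//; lra.
apply: le_trans rB _; rewrite -mulrA mulrCA ler_pM2l//; lra.
Qed.

(** * The prior of one coordinate *)

Section coordinate_prior.
Context {R : realType}.

Lemma cos_half (y : R) : cos y = 1 - 2 * sin (y / 2) ^+ 2.
Proof.
rewrite {1}(_ : y = (y / 2) *+ 2); last by field.
by rewrite cos_mulr2n cos2sin2; ring.
Qed.

Lemma sin_half (y : R) : sin y = 2 * sin (y / 2) * cos (y / 2).
Proof.
rewrite {1}(_ : y = (y / 2) *+ 2); last by field.
by rewrite sin_mulr2n; ring.
Qed.

Lemma pi_le4 : pi <= 4 :> R.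
Proof. by have := @pihalf_lt2 R; lra. Qed.

Lemma expR_le1D3x (z : R) : 0 <= z <= 1 -> expR z <= 1 + 3 * z.
Proof.
move=> /andP[z0 z1].
have : 1 - z / 2 <= expR (- (z / 2)) by have := expR_ge1Dx (- (z / 2)); lra.
have e0 := expR_gt0 (z / 2).
rewrite expRN -[X in X <= _]invrK lef_pV2 ?posrE ?invr_gt0; [|lra|by []].
move=> e1; have -> : expR z = expR (z / 2) ^+ 2 by rewrite expr2 -expRD; congr expR; field.
have z2 : 0 < 1 - z / 2 by lra.
apply: (@le_trans _ _ ((1 - z / 2)^-1 ^+ 2)).
  by rewrite ler_pXn2r// ?nnegrE ?invr_ge0 ltW.
rewrite exprVn -[leLHS]mul1r ler_pdivrMr ?exprn_gt0//.
rewrite -subr_ge0 (_ : _ - _ = z / 4 * (1 - z) * (8 - 3 * z)); last by field.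
by rewrite !mulr_ge0//; lra.
Qed.

(** The 3 in [c / 3] absorbs the 8, as [1 / 9 <= 1 / 8]. *)
Lemma sqr_signal (c m X Y t : R) : 0 < c -> 0 < m -> 0 < t -> 0 < X -> X / (8 * t) <= Y ->
  X * t * m^-1 ^+ 2 * (c / 3) ^+ 2 <= t ^+ 2 * (Y * (c / m) ^+ 2).
Proof.
move=> c0 m0 t0 X0 XY.
apply: (@le_trans _ _ (t ^+ 2 * (X / (8 * t) * (c / m) ^+ 2))); last first.
  by rewrite ler_pM2l ?exprn_gt0// ler_wpM2r// sqr_ge0.
rewrite -subr_ge0 (_ : _ - _ = X * t * (c / m) ^+ 2 * (1 / 72)); last first.
  by field; rewrite !gt_eqF.
apply: mulr_ge0; last by rewrite div1r invr_ge0 ler0n.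
by apply: mulr_ge0; [apply: mulr_ge0; exact: ltW|exact: sqr_ge0].
Qed.

(** In half angles, [cot (2 h) >= M / 2]: with the kink at its first position the signal is of order
    [tau], without the factor [1 / M]. *)
Lemma cot_first (M : nat) (h : R) : (0 < M)%N -> 8 * M%:R * h = pi ->
  M%:R / 2 * (1 - cos (4 * h)) <= sin (4 * h).
Proof.
move=> M0 hM; have M1 : 1 <= M%:R :> R by rewrite ler1n.
have pi0 := @pi_gt0 R; have pi4 := pi_le4.
have h0 : 0 < h by rewrite -(@pmulr_rgt0 _ (8 * M%:R)) ?hM//; lra.
have h8 : 8 * h <= pi by rewrite -hM; nra.
rewrite (cos_half (4 * h)) (sin_half (4 * h)) (_ : 4 * h / 2 = 2 * h); last by field.
have c2 : 1 / 2 <= cos (2 * h) by apply: cos_ge_half; apply/andP; split; lra.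
have s2 : sin (2 * h) <= 2 * h by apply: sin_le_id; lra.
have s0 : 0 <= sin (2 * h) by apply: sin_ge0_pi; apply/andP; split; lra.
have Mh : M%:R * sin (2 * h) <= 1.
  apply: (@le_trans _ _ (M%:R * (2 * h))); first by rewrite ler_pM2l//; lra.
  by rewrite (_ : M%:R * (2 * h) = pi / 4); [lra|rewrite -hM; field].
rewrite (_ : M%:R / 2 * _ = sin (2 * h) * (M%:R * sin (2 * h))); last by field.
rewrite (_ : 2 * sin (2 * h) * _ = sin (2 * h) * (2 * cos (2 * h))); last by ring.
rewrite ler_wpM2l//; lra.
Qed.

(** For [K >= 2] the previous angle is at least half of the present one, so [1 - cos] grows by a
    factor at most 4 and stays below [4 s]. *)
Lemma cot_later (K : nat) (h s : R) : (1 < K)%N -> 0 < h -> (4 * K)%:R * h <= pi / 2 ->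
  1 - cos ((4 * K.-1)%:R * h) < s ->
  (1 - cos ((4 * K)%:R * h)) ^+ 2 <= 8 * s * sin ((4 * K)%:R * h) ^+ 2.
Proof.
move=> K1 h0 bp cs; set b := (4 * K)%:R * h in bp *; set b' := (4 * K.-1)%:R * h in cs.
have bb' : b / 2 <= b'.
  rewrite /b /b' -subr_ge0 (_ : _ - _ = (2 * (K - 2))%:R * h).
    by rewrite mulr_ge0 ?ler0n ?(ltW h0).
  case: K K1 {bp cs b b'} => [|[|K]]//= _.
  by rewrite subSS subSS subn0 !natrM -!natr1; field.
have b'b : b' <= b by rewrite /b /b' ler_pM2r// ler_nat; lia.
have b0 : 0 < b by rewrite mulr_gt0// ltr0n; lia.
have pi0 := @pi_gt0 R.
have s1 : sin (b / 2) <= sin b' by rewrite ler_sin ?in_itv//=; apply/andP; split; lra.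
have s'0 : 0 <= sin (b' / 2) by apply: sin_ge0_pi; apply/andP; split; lra.
have s0 : 0 <= sin (b / 2) by apply: sin_ge0_pi; apply/andP; split; lra.
have s2 : sin b' <= 2 * sin (b' / 2).
  by rewrite sin_half ler_piMr ?cos_le1// mulr_ge0.
have c2 : 1 / 2 <= cos (b / 2) by apply: cos_ge_half; apply/andP; split; lra.
move: cs; rewrite (cos_half b') (cos_half b) (sin_half b).
have s3 : sin (b / 2) <= 2 * sin (b' / 2) by exact: le_trans s2.
have s4 : sin (b / 2) ^+ 2 <= 4 * sin (b' / 2) ^+ 2.
  by rewrite (_ : 4 * _ = (2 * sin (b' / 2)) ^+ 2); [rewrite ler_pXn2r// nnegrE mulr_ge0|ring].
have c3 : 1 / 4 <= cos (b / 2) ^+ 2 by rewrite (_ : 1 / 4 = (1 / 2) ^+ 2); [rewrite ler_pXn2r// nnegrE; lra|field].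
move: s4 c3; set y := sin (b / 2); set c := cos (b / 2) ^+ 2; set y' := sin _ ^+ 2 => s4 c3 cs.
have y2 : 0 <= y ^+ 2 by rewrite sqr_ge0.
rewrite (_ : (1 - (1 - 2 * y ^+ 2)) ^+ 2 = y ^+ 2 * (4 * y ^+ 2)); last by ring.
rewrite (_ : 8 * s * _ = y ^+ 2 * (32 * s * c)); last by rewrite /c; ring.
rewrite ler_wpM2l//; move: y2 s4; move: (y ^+ 2) => z y2 s4.
have : s * 4^-1 <= s * c by rewrite ler_wpM2l; lra.
lra.
Qed.

(** For [tau >= M0] the support is centred at [tau] with half-width [sqrt (M0 tau)]. For [tau < M0]
    it lies in [[0, 2 w]] with [w <= M0], and [K] places the kink at [tau], near the left end. The
    exponential moments serve a Chernoff bound on the total mass. *)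
Lemma coordinate_prior : exists2 c : R, 0 < c &
  forall (M : nat) (M0 tau : R), (0 < M)%N -> 0 < M0 -> 0 < tau ->
  exists (mu nu x : 'I_(16 * M) -> R) (a w : R),
  let q i := a + w * x i in
  let f i := Num.max (tau - q i) 0 in
  [/\ forall i, 0 <= mu i, forall i, 0 <= nu i, \sum_i mu i = 1 & \sum_i nu i = 1] /\
  [/\ forall i, `|x i| <= 1, 0 < w, w <= a & w ^+ 2 <= M0 * a] /\
  [/\ w ^+ 2 <= M0 * tau + M0 ^+ 2, a <= tau + M0,
     forall j, (j < 4 * M)%N -> \sum_i mu i * x i ^+ j = \sum_i nu i * x i ^+ j &
     \sum_i mu i * f i + Num.min tau (Num.sqrt (M0 * tau) / M%:R) * (c / 3) <= \sum_i nu i * f i] /\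
  [/\ \sum_i mu i * q i = tau, \sum_i nu i * q i = tau,
     \sum_i mu i * expR (q i / (2 * M0)) <= expR (2 * tau / M0) &
     \sum_i nu i * expR (q i / (2 * M0)) <= expR (2 * tau / M0)].
Proof.
have [c c0 cE] : exists2 c : R, 0 < c & forall m x : R, 0 < m -> x / (288 * pi * m) = x * (c / m).
  exists (288 * pi)^-1; last by move=> m x m0; rewrite invfM.
  by rewrite invr_gt0 (pmulr_lgt0 _ (@pi_gt0 R)) ltr0n.
exists c => // M M0 tau M_gt0 M0_gt0 tau0.
have m0 : 0 < M%:R :> R by rewrite ltr0n.
pose h : R := pi / (8 * M%:R).
have hM : 8 * M%:R * h = pi by rewrite /h mulrC divfK// gt_eqF// mulr_gt0.
have pi0 := @pi_gt0 R; have pi4 := pi_le4.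
have h0 : 0 < h by rewrite divr_gt0// mulr_gt0.
pose be (K : nat) := (4 * K)%:R * h.
have beM : be M = pi / 2 by rewrite /be -hM natrM; field.
have be_le K : (K <= M)%N -> be K <= pi / 2 by move=> KM; rewrite -beM ler_pM2r// ler_nat; lia.
have be_gt0 K : (0 < K)%N -> 0 < be K by move=> K0; rewrite mulr_gt0// ltr0n; lia.
suff [K [a [w [/andP[K0 KM] w0 wa [w2 w2' aM] [atau qM D]]]]] : exists (K : nat) (a w : R),
  [/\ (0 < K <= M)%N, 0 < w, w <= a,
   [/\ w ^+ 2 <= M0 * a, w ^+ 2 <= M0 * tau + M0 ^+ 2 & a <= tau + M0] &
   [/\ tau = a - w * cos (be K),
     a + w <= 2 * tau \/ (a + w <= 2 * M0) &
     Num.min tau (Num.sqrt (M0 * tau) / M%:R) * (c / 3) <= w * (sin (be K) * (c / M%:R))]].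
  have [mu [nu [[mu0 nu0 mu1 nu1] [mom mux nux sig]]]] := @extremal_pair R M K h (be K) K0 KM hM erefl.
  rewrite (cE _ _ m0) in sig.
  set x := (fun i : 'I_(16 * M) => - cos (i%:R * h)) in mom mux nux sig.
  exists mu, nu, x, a, w => q f.
  have x1 i : `|x i| <= 1 by rewrite /x normrN cos_max.
  have fE i : f i = w * Num.max (- cos (be K) - x i) 0.
    rewrite /f /q atau maxr_pMr ?ltW// mulr0; congr (Num.max _ _); ring.
  have meanE (m : 'I_(16 * M) -> R) : \sum_i m i = 1 -> \sum_i m i * x i = - cos (be K) ->
      \sum_i m i * q i = tau.
    move=> m1' mx; under eq_bigr do rewrite /q mulrDr mulrCA.
    by rewrite big_split/= -mulr_suml -mulr_sumr m1' mx atau; ring.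
  have expE (m : 'I_(16 * M) -> R) : (forall i, 0 <= m i) -> \sum_i m i = 1 -> \sum_i m i * q i = tau ->
      \sum_i m i * expR (q i / (2 * M0)) <= expR (2 * tau / M0).
    move=> m_ge0 m1' mq.
    have q_bounds i : 0 <= q i /\ q i <= a + w.
      move: (x1 i); rewrite ler_norml => /andP[xl xu]; split.
        by rewrite -lerBlDl sub0r; apply: (@le_trans _ _ (- w)); rewrite ?lerN2// -mulrN1 ler_pM2l.
      by rewrite lerD2l -[leRHS]mulr1 ler_pM2l.
    have q_ge0 i : 0 <= q i.
      by case: (q_bounds i).
    have q_le i : q i <= a + w.
      by case: (q_bounds i).
    (* Either [q <= 2 tau] and the supremum is enough, or [q / (2 M0) <= 1] and linearising the
       exponential reduces the bound to the mean [tau]. *)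
    case: qM => qM.
      apply: (@le_trans _ _ (\sum_i m i * expR (2 * tau / M0))); last first.
        by rewrite -mulr_suml m1' mul1r.
      apply: ler_sum => i _; rewrite ler_wpM2l// ler_expR.
      have qi : q i <= 2 * tau by exact: le_trans qM.
      rewrite ler_pdivrMr ?mulr_gt0// (_ : 2 * tau / M0 * (2 * M0) = 2 * tau + 2 * tau); last first.
        by field; rewrite gt_eqF.
      lra.
    apply: (@le_trans _ _ (1 + 2 * tau / M0)); last exact: expR_ge1Dx.
    apply: (@le_trans _ _ (\sum_i m i * (1 + 3 * (q i / (2 * M0))))).
      apply: ler_sum => i _; rewrite ler_wpM2l// expR_le1D3x// divr_ge0 ?mulr_ge0 ?(ltW M0_gt0)//=.
      by rewrite ler_pdivrMr ?mulr_gt0// mul1r (le_trans (q_le i)).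
    have -> : \sum_i m i * (1 + 3 * (q i / (2 * M0))) = \sum_i m i + 3 / (2 * M0) * \sum_i m i * q i.
      by rewrite mulr_sumr -big_split; apply: eq_bigr => i _ /=; field; rewrite gt_eqF.
    rewrite m1' mq lerD2l (_ : 3 / _ * _ = 3 / 2 * (tau / M0)); last by field; rewrite gt_eqF.
    have : 0 < tau / M0 by rewrite divr_gt0.
    rewrite -mulrA; lra.
  split=> //; split=> //; split.
    split=> //; under eq_bigr do rewrite fE mulrCA; under [leRHS]eq_bigr do rewrite fE mulrCA.
    rewrite -!mulr_sumr; apply: le_trans (ler_wpM2l (ltW w0) sig).
    by rewrite mulrDr lerD2l.
  by split; [exact: meanE|exact: meanE|apply: expE => //; exact: meanE|apply: expE => //; exact: meanE].
have rM0 : 0 < Num.sqrt (M0 * tau) by rewrite sqrtr_gt0 mulr_gt0.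
have [tM|Mt] := ltP tau M0; last first.
  exists M, tau, (Num.sqrt (M0 * tau)).
  have w2 : Num.sqrt (M0 * tau) ^+ 2 = M0 * tau by rewrite sqr_sqrtr// mulr_ge0// ltW.
  have wt : Num.sqrt (M0 * tau) <= tau.
    by rewrite -(@ler_pXn2r _ 2)// ?nnegrE ?(ltW tau0) ?(ltW rM0)// w2 expr2 ler_wpM2r// (ltW tau0).
  split=> //; first by rewrite M_gt0 leqnn.
    by rewrite w2; split; [|rewrite lerDl sqr_ge0|rewrite lerDl (ltW M0_gt0)].
  have c3 : 0 <= c / 3 by rewrite divr_ge0 ?(ltW c0).
  rewrite beM cos_pihalf sin_pihalf mulr0 subr0; split => //; first by left; rewrite mulr_natl mulr2n lerD2l.
  apply: (@le_trans _ _ (Num.sqrt (M0 * tau) / M%:R * (c / 3))).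
    by apply: ler_wpM2r; rewrite // ge_min lexx orbT.
  rewrite mul1r -mulrA; apply: ler_wpM2l; first exact: ltW.
  by rewrite mulrC ler_pM2r ?invr_gt0//; lra.
have s0 : 0 < tau / M0 by rewrite divr_gt0.
have s1 : tau / M0 < 1 by rewrite ltr_pdivrMr// mul1r.
(* The least [K] for which [w = tau / (1 - cos beta)] does not exceed [M0]. *)
have exK : exists K : nat, (0 < K)%N && (tau / M0 <= 1 - cos (be K)).
  by exists M; rewrite M_gt0 beM cos_pihalf subr0 ltW.
case: (ex_minnP exK) => K /andP[K0 Ks] Kmin.
have KM : (K <= M)%N by apply: Kmin; rewrite M_gt0 beM cos_pihalf subr0 ltW.
have d0 : 0 < 1 - cos (be K) by apply: lt_le_trans Ks.
have w0 : 0 < tau / (1 - cos (be K)) by rewrite divr_gt0.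
have wM : tau / (1 - cos (be K)) <= M0.
  by move: Ks; rewrite ler_pdivrMr// ler_pdivrMr// mulrC.
exists K, (tau / (1 - cos (be K))), (tau / (1 - cos (be K))).
split=> //; first by rewrite K0 KM.
  have M0' := ltW M0_gt0; have w0' := ltW w0.
  split; rewrite ?expr2.
  - by rewrite ler_wpM2r.
  - apply: (@le_trans _ _ (M0 * M0)); first by rewrite ler_pM.
    by rewrite lerDr mulr_ge0 ?(ltW tau0).
  - by apply: (le_trans wM); rewrite lerDr ltW.
split; first by field; rewrite gt_eqF.
  by right; rewrite mulr_natl mulr2n lerD.
have c3 : 0 <= c / 3 by rewrite divr_ge0 ?(ltW c0).
have sb0 : 0 < sin (be K).
  by apply: sin_gt0_pi; rewrite be_gt0//= (le_lt_trans (be_le _ KM))// ltr_pdivrMr// mulr_natr mulr2n ltrDl.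
(* For [K = 1] the signal is compared with the first entry of the minimum, otherwise with the
   second. *)
have [K1|K1] := leqP K 1.
  have KE : K = 1%N by apply/eqP; rewrite eqn_leq K1 K0.
  have := cot_first M_gt0 hM; rewrite (_ : 4 * h = be K); last by rewrite /be KE muln1.
  rewrite -ler_pdivlMr// => cot.
  apply: (@le_trans _ _ (tau * (c / 3))); first by apply: ler_wpM2r; rewrite // ge_min lexx.
  rewrite [leRHS](_ : _ = tau * (sin (be K) / (1 - cos (be K)) * (c / M%:R))); last first.
    by field; rewrite !gt_eqF.
  rewrite ler_pM2l// -ler_pdivrMr ?divr_gt0//; apply: le_trans cot.
  rewrite (_ : c / 3 / (c / M%:R) = M%:R / 3); last by field; rewrite !gt_eqF.
  by rewrite ler_pM2l//; lra.
have := @cot_later K h (tau / M0) K1 h0 (be_le _ KM).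
have -> : 1 - cos ((4 * K.-1)%:R * h) < tau / M0.
  rewrite ltNge; apply/negP => H; have := Kmin K.-1.
  by rewrite H andbT -ltnS (ltn_predK K1) K1 => /(_ isT); rewrite -ltnS (ltn_predK K1) ltnn.
move=> /(_ isT); rewrite -/(be K) => cot.
apply: (@le_trans _ _ (Num.sqrt (M0 * tau) / M%:R * (c / 3))).
  by apply: ler_wpM2r; rewrite // ge_min lexx orbT.
rewrite -(@ler_pXn2r _ 2)// ?nnegrE; last 2 first.
- by rewrite !mulr_ge0 ?invr_ge0 ?ler0n ?(ltW rM0) ?(ltW c0).
- by rewrite !mulr_ge0 ?invr_ge0 ?ler0n ?(ltW d0) ?(ltW tau0) ?(ltW sb0) ?(ltW c0).
rewrite [leLHS]exprMn [(_ / M%:R) ^+ 2]exprMn sqr_sqrtr ?mulr_ge0 ?(ltW M0_gt0) ?(ltW tau0)//.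
have X : M0 / (8 * tau) <= sin (be K) ^+ 2 / (1 - cos (be K)) ^+ 2.
  rewrite ler_pdivlMr ?exprn_gt0//.
  have c8 : 0 <= M0 / (8 * tau) by rewrite divr_ge0 ?mulr_ge0 ?(ltW tau0) ?(ltW M0_gt0).
  apply: le_trans (ler_wpM2l c8 cot) _; rewrite le_eqVlt; apply/orP; left; apply/eqP.
  by field; rewrite !gt_eqF.
apply: le_trans (sqr_signal c0 m0 tau0 M0_gt0 X) _.
rewrite le_eqVlt; apply/orP; left; apply/eqP.
by field; rewrite !gt_eqF.
Qed.

End coordinate_prior.

(** * Mixtures and the minimax risk *)

Section mixture.
Context {R : realType} (S n N : nat) (m : 'I_S) (q : 'I_S -> 'I_N -> R).
Hypotheses (q0 : forall j t, 0 <= q j t) (qm : forall t, q m t = 0).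
Implicit Types (u : {ffun 'I_S -> 'I_N}) (s : 'I_S).

Definition total u : R := \sum_j q j (u j).

(* The coordinate [m] absorbs the missing mass; the point mass at [m] is a junk
   value outside the likely event [total u <= 3 / 4]. *)
Definition law u : S.-tuple R :=
  if total u <= 3 / 4 then [tuple if l == m then 1 - total u else q l (u l) | l < S]
  else [tuple (l == m)%:R | l < S].

Lemma law_distribution u : distributions S (law u).
Proof.
rewrite /law; case: ifPn => tot; split.
- move=> i; rewrite tnth_mktuple; case: ifP => _ //; rewrite subr_ge0; lra.
- under eq_bigr do rewrite tnth_mktuple.
  rewrite (bigD1 m)//= eqxx /total (bigD1 m)//= qm add0r.
  by rewrite [X in _ + X](eq_bigr (fun l => q l (u l))) ?subrK// => l /negPf ->.
- by move=> i; rewrite tnth_mktuple ler0n.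
- under eq_bigr do rewrite tnth_mktuple.
  by rewrite (bigD1 m)//= eqxx big1 ?addr0// => l /negPf ->.
Qed.

Lemma total_update u s t :
  total (update u s t) = q s t + \sum_(j | j != s) q j (u j).
Proof.
rewrite /total (bigD1 s)//= ffunE eqxx; congr (_ + _).
by apply: eq_bigr => j /negPf js; rewrite ffunE js.
Qed.

Lemma sum_others_le u s : \sum_(j | j != s) q j (u j) <= total u.
Proof. by rewrite /total [leRHS](bigD1 s)//= lerDr. Qed.

Lemma coordinate_tv s (mu nu x : 'I_N -> R) (a w theta eta : R) k u E :
  m != s -> (forall t, q s t = a + w * x t) -> 0 < w -> w <= a -> a <= 1 / 4 ->
  (forall t, `|x t| <= 1) ->
  (forall t, 0 <= mu t) -> \sum_t mu t = 1 -> (forall t, 0 <= nu t) -> \sum_t nu t = 1 ->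
  (forall j, (j < k)%N -> \sum_t mu t * x t ^+ j = \sum_t nu t * x t ^+ j) ->
  1 <= theta -> 0 < eta ->
  4 * theta ^- k * expR (theta * (n%:R * w ^+ 2 * (2 / a))) <= eta ^+ 2 ->
  \sum_(j | j != s) q j (u j) <= 1 / 4 ->
  \sum_t (nu t - mu t) * prob n (law (update u s t)) E <= eta.
Proof.
move=> ms qs w0 wa a4 x1 mu0 mu1 nu0 nu1 mom t1 eta0 chi others.
have a0 : 0 < a by apply: lt_le_trans wa.
pose o := \sum_(j | j != s) q j (u j).
have th0 : 0 <= theta by apply: le_trans t1.
have o0 : 0 <= o by apply: sumr_ge0.
pose b := 1 - o - a.
have ab : a <= b by rewrite /b; move: others; rewrite -/o; lra.
have b0 : 0 < b by apply: lt_le_trans ab.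
have lawE t : law (update u s t) = shifted s m a b (fun l => q l (u l)) (w * x t) 0.
  have wx : w * x t <= w by rewrite -[leRHS]mulr1 ler_pM2l// (le_trans (ler_norm _)).
  rewrite /law total_update -/o qs ifT; last by move: others; rewrite -/o; lra.
  apply: eq_from_tnth => l; rewrite !tnth_mktuple.
  have [->|lm] := eqVneq l m.
    rewrite (negPf ms) subr0 mulfK ?gt_eqF// /b; ring.
  have [->|ls] := eqVneq l s; last by rewrite ffunE (negPf ls).
  by rewrite ffunE eqxx qs addr0 mulfK ?gt_eqF.
under eq_bigr do rewrite lawE.
apply: (@shift_tv R S n s m a b _ ms a0 b0 N (fun t => nu t - mu t) x w theta eta k E) => //.
- exact: ltW.
- exact: le_trans ab.
- apply: (@le_trans _ _ (\sum_t (nu t + mu t))).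
    apply: ler_sum => t _; rewrite (le_trans (ler_normB _ _))// !ger0_norm//.
  by rewrite big_split/= mu1 nu1.
- move=> j jk; under eq_bigr do rewrite mulrBl.
  by rewrite sumrB mom// subrr.
- apply: le_trans chi; rewrite ler_wpM2l//.
    by rewrite divr_ge0// exprn_ge0.
  rewrite ler_expR; apply: ler_wpM2l => //; apply: ler_wpM2l; first by rewrite mulr_ge0 ?sqr_ge0.
  have : b^-1 <= a^-1 by rewrite lef_pV2.
  move: (a^-1) (b^-1) => y z yz; lra.
Qed.

Lemma bracket_le1 s (mu nu : 'I_N -> R) u E :
  (forall t, 0 <= mu t) -> (forall t, 0 <= nu t) -> \sum_t nu t = 1 ->
  \sum_t (nu t - mu t) * prob n (law (update u s t)) E <= 1.
Proof.
move=> mu0 nu0 <-; apply: ler_sum => t _.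
have p0 := prob_ge0 n (law (update u s t)) E; have p1 := prob_le1 n (law (update u s t)) E.
apply: (@le_trans _ _ (nu t * prob n (law (update u s t)) E)).
  by rewrite ler_wpM2r// gerBl.
by rewrite ler_piMr.
Qed.

(** Frozen mass above [1 / 4] is only unlikely: there the bracket is at most 1, hence at most
    [exp (lambda (total - 1 / 4))], whose expectation factors over the coordinates. *)
Lemma mixture_tv (mu nu : 'I_S -> 'I_N -> R) (eta lambda : R) (th : 'I_S -> R) E :
  is_weight mu -> is_weight nu -> 0 < lambda -> 0 <= eta ->
  (forall s u, \sum_(j | j != s) q j (u j) <= 1 / 4 ->
    \sum_t (nu s t - mu s t) * prob n (law (update u s t)) E <= eta) ->
  (forall s, \sum_t mu s t * expR (q s t * lambda) <= expR (th s)) ->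
  (forall s, \sum_t nu s t * expR (q s t * lambda) <= expR (th s)) ->
  expect nu (fun u => prob n (law u) E) - expect mu (fun u => prob n (law u) E) <=
  S%:R * (eta + expR (\sum_s th s - lambda / 4)).
Proof.
move=> hmu hnu lambda0 eta0 br emu enu; rewrite expect_hybrid//.
rewrite mulr_natl -[X in _ *+ X]card_ord -sumr_const; apply: ler_sum => s _.
have hh := hybrid_weight s hmu hnu; set h := hybrid mu nu s in hh *.
apply: (@le_trans _ _ (expect h (fun u => eta + expR (- (lambda / 4)) * \prod_j expR (q j (u j) * lambda)))).
  apply: expect_le => // u; have [le4|gt4] := leP (\sum_(j | j != s) q j (u j)) (1 / 4).
    apply: (le_trans (br s u le4)); rewrite lerDl mulr_ge0 ?expR_ge0//.
    by apply: prodr_ge0 => j _; exact: expR_ge0.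
  apply: (le_trans (@bracket_le1 s _ _ u E (hmu s).1 (hnu s).1 (hnu s).2)).
  apply: (@le_trans _ _ (expR (- (lambda / 4)) * \prod_j expR (q j (u j) * lambda))); last by rewrite lerDr.
  rewrite -expR_sum -expRD -{1}expR0 ler_expR -mulr_suml -/(total u).
  have := sum_others_le u s; move: gt4; set o := \sum_(j | _) _ => gt4 ou.
  have : 1 / 4 <= total u by apply: le_trans ou; exact: ltW.
  rewrite -(ler_pM2r lambda0); lra.
rewrite expectD expect_cst// expectZ (expect_prod h (fun j t => expR (q j t * lambda))) lerD2l.
rewrite addrC expRD ler_wpM2l ?expR_ge0// expR_sum; apply: ler_prod => j _.
rewrite sumr_ge0 => [|t _]; last by rewrite mulr_ge0 ?expR_ge0// (hh j).1.
by rewrite /h /hybrid; case: ifP => _; [exact: enu|exact: emu].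
Qed.

End mixture.

Lemma measurable_nat_tuple S (A : set (S.-tuple nat)) : measurable A.
Proof.
apply: countable_measurable; last exact: countableP.
move=> k; rewrite (_ : [set k] = \big[setI/setT]_(i < S) ((@tnth _ nat ^~ i) @^-1` [set tnth k i])).
  apply: bigsetI_measurable => i _.
  by rewrite -[X in measurable X]setTI; apply: measurable_tnth.
rewrite -bigcap_seq; apply/seteqP; split => [_ -> i //|l /= lk].
by apply: eq_from_tnth => i; apply: (lk i) => /=; rewrite mem_index_enum.
Qed.

(** * From indistinguishable mixtures to the minimax risk *)

Section risk_lower_bound.
Context {R : realType}.

Lemma risk_markov S n (eps : R) (P Q : S.-tuple R) (dhat : S.-tuple R -> R) (d : R) : 0 <= d ->
  ((d ^+ 2 * prob n Q [set k | (d <= `|dhat (empirical n k) - hockey_stick eps P Q|)%R])%:E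
    <= risk n eps P dhat Q)%E.
Proof.
move=> d0; set A := [set k | _]; rewrite /risk unlock EFinM probE.
have mA := measurable_nat_tuple A.
rewrite -(integral_cst (poisson_sample n Q) mA (d ^+ 2)%:E).
apply: (@le_trans _ _ (\int[poisson_sample n Q]_(k in A)
    (`|dhat (empirical n k) - hockey_stick eps P Q| ^+ 2)%:E)%E).
  apply: ge0_le_integral => //.
  - by move=> k _; rewrite lee_fin sqr_ge0.
  - by move=> _ Y _; exact: measurable_nat_tuple.
  - by move=> k Ak; rewrite lee_fin ler_pXn2r ?nnegrE.
apply: ge0_subset_integral => //.
by move=> _ Y _; exact: measurable_nat_tuple.
Qed.

(** Budget of the test comparing [dhat] with the midpoint of the two means: a risk below
    [Delta ^ 2 / 128 = (Delta / 4) ^ 2 / 8] leaves [1 / 8] for an estimation error of [Delta / 4];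
    at most [1 / 4] goes to [d_eps] being [Delta / 4] off its mean or to a total above [cut]. Two
    errors of at most [3 / 8] separate the mixtures by [1 / 4], more than the last hypothesis
    allows. *)
Lemma minimax_ge S n N (m : 'I_S) (q g mu nu : 'I_S -> 'I_N -> R) (eps : R) (P : S.-tuple R)
    (Delta cut : R) :
  (forall j t, 0 <= q j t) -> (forall t, q m t = 0) ->
  is_weight mu -> is_weight nu -> 0 < Delta -> 0 < cut ->
  (forall u, total q u <= cut -> hockey_stick eps P (law m q u) = \sum_i g i (u i)) ->
  \sum_i \sum_t mu i t * g i t + Delta <= \sum_i \sum_t nu i t * g i t ->
  (forall w, w = mu \/ w = nu ->
    \sum_i \sum_t w i t * (g i t - \sum_t' w i t' * g i t') ^+ 2 <= Delta ^+ 2 / 128 /\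
    \sum_i \sum_t w i t * q i t <= cut / 32) ->
  (forall E, expect nu (fun u => prob n (law m q u) E) -
     expect mu (fun u => prob n (law m q u) E) <= 1 / 8) ->
  ((Delta ^+ 2 / 128)%:E <= minimax_risk n eps P)%E.
Proof.
move=> q0 qm hmu hnu D0 cut0 dE gap bounds tv.
apply: le_ereal_inf_tmp => _ [dhat _ <-]; rewrite leNgt; apply/negP => sup_lt.
set d := Delta / 4; have d0 : 0 < d by rewrite divr_gt0.
have small u : prob n (law m q u)
    [set k | (d <= `|dhat (empirical n k) - hockey_stick eps P (law m q u)|)%R] <= 1 / 8.
  have le_sup : (risk n eps P dhat (law m q u) <=
      ereal_sup [set risk n eps P dhat Q | Q in distributions S])%E.
    by apply: ereal_sup_ubound; exists (law m q u) => //; exact: law_distribution.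
  have := le_lt_trans (le_trans (risk_markov n eps P (law m q u) dhat (ltW d0)) le_sup) sup_lt.
  rewrite lte_fin => /ltW; set p := prob _ _ _ => dp.
  have d2 : 0 < d ^+ 2 by rewrite exprn_gt0.
  rewrite -(ler_pM2l d2); apply: (le_trans dp).
  by rewrite (_ : Delta ^+ 2 / 128 = d ^+ 2 * (1 / 8))//; rewrite /d; field.
pose mean w := \sum_i \sum_t w i t * g i t.
pose bad (w : 'I_S -> 'I_N -> R) (u : {ffun 'I_S -> 'I_N}) : R := ((d < `|\sum_i g i (u i) - mean w|)%R%:R + (cut < total q u)%R%:R).
have bad_le w : is_weight w -> w = mu \/ w = nu -> expect w (bad w) <= 1 / 4.
  move=> hw /bounds[var tot]; rewrite expectD.
  have := chebyshev_expect hw g d0; rewrite -/(mean w) => cheb.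
  have total0 u : 0 <= total q u by apply: sumr_ge0.
  have mark := markov_expect hw cut0 total0.
  have d2 : 0 < d ^+ 2 by rewrite exprn_gt0.
  have E1 : (\sum_i \sum_t w i t * (g i t - \sum_t' w i t' * g i t') ^+ 2) / d ^+ 2 <= 1 / 8.
    rewrite ler_pdivrMr//; apply: (le_trans var).
    by rewrite (_ : Delta ^+ 2 / 128 = 1 / 8 * d ^+ 2)//; rewrite /d; field.
  have E2 : expect w (total q) / cut <= 1 / 32.
    rewrite ler_pdivrMr// (_ : expect w (total q) = \sum_i \sum_t w i t * q i t).
      by apply: le_trans tot _; rewrite mulrC; lra.
    rewrite (expect_sum w (fun j u => q j (u j))); apply: eq_bigr => j _.
    by rewrite (expect_coord hw).
  have := le_trans cheb E1; have := le_trans mark E2.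
  move: (expect w _) (expect w _) => y z; lra.
pose theta := (mean mu + mean nu) / 2.
pose E := [set k | (theta < dhat (empirical n k))%R].
have gap' : mean mu + Delta <= mean nu by exact: gap.
have bad0 w u : 0 <= bad w u by rewrite addr_ge0.
have mono Q (A B : set (S.-tuple nat)) : A `<=` B -> prob n Q A <= prob n Q B.
  move=> AB; rewrite -lee_fin !probE le_measure// inE; exact: measurable_nat_tuple.
have up : expect mu (fun u => prob n (law m q u) E) <= 1 / 8 + 1 / 4.
  apply: (@le_trans _ _ (expect mu (fun u => 1 / 8 + bad mu u))); last first.
    by rewrite expectD (expect_cst hmu) lerD2l; apply: bad_le; [|left].
  apply: expect_le => // u; rewrite /bad.
  case: (ltP d) => [_|dev].
    by rewrite (le_trans (prob_le1 _ _ _))// addrCA lerDl addr_ge0// divr_ge0.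
  case: (ltP cut) => [_|tot].
    by rewrite (le_trans (prob_le1 _ _ _))// add0r lerDr divr_ge0.
  rewrite !addr0; apply: le_trans (small u); apply: mono => k Ek'; rewrite /= dE//.
  have Ek : theta < dhat (empirical n k) by exact: Ek'.
  move: dev; rewrite ler_distl => /andP[_ dev].
  rewrite (le_trans _ (ler_norm _))//; move: Ek gap'; rewrite /theta /d in dev *.
  move: (mean mu) (mean nu) (dhat _) (\sum_i _) dev => a b c e dev Ek gap2; lra.
have dn : expect nu (fun u => prob n (law m q u) (~` E)) <= 1 / 8 + 1 / 4.
  apply: (@le_trans _ _ (expect nu (fun u => 1 / 8 + bad nu u))); last first.
    by rewrite expectD (expect_cst hnu) lerD2l; apply: bad_le; [|right].
  apply: expect_le => // u; rewrite /bad.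
  case: (ltP d) => [_|dev].
    by rewrite (le_trans (prob_le1 _ _ _))// addrCA lerDl addr_ge0// divr_ge0.
  case: (ltP cut) => [_|tot].
    by rewrite (le_trans (prob_le1 _ _ _))// add0r lerDr divr_ge0.
  rewrite !addr0; apply: le_trans (small u); apply: mono => k Ek'; rewrite /= dE//.
  have Ek : dhat (empirical n k) <= theta by rewrite leNgt; apply/negP; exact: Ek'.
  move: dev; rewrite ler_distl => /andP[dev _].
  rewrite distrC (le_trans _ (ler_norm _))//; move: Ek gap'; rewrite /theta /d in dev *.
  move: (mean mu) (mean nu) (dhat _) (\sum_i _) dev => a b c e dev Ek gap2; lra.
have : expect nu (fun u => prob n (law m q u) E) + expect nu (fun u => prob n (law m q u) (~` E)) = 1.
  rewrite -expectD -[RHS](expect1 hnu); apply: expect_eq => u; exact: probC.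
have := tv E; move: up dn; move: (expect mu _) (expect nu _) (expect nu _) => x y z; lra.
Qed.

End risk_lower_bound.

(** * Choice of the constants *)

Section numeric_bounds.
Context {R : realType}.
Implicit Types (n S M : nat) (L T kappa c e p t : R).
Local Notation lnR n := (@ln R n%:R).

Lemma ln_ge_half n : (2 <= n)%N -> 1 / 2 <= lnR n.
Proof.
move=> n2; have n2R : 2 <= n%:R :> R by rewrite ler_nat.
have h : 1 + - (1 / 2) = 2^-1 :> R by field.
have h1 : -1 < - (1 / 2) :> R by lra.
have := le_ln1Dx h1; rewrite h lnV ?posrE// => l2.
have : ln (2 : R) <= lnR n by rewrite ler_ln// posrE; lra.
lra.
Qed.

Lemma ln_sqr_le n : (2 <= n)%N -> lnR n ^+ 2 <= 4 * n%:R.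
Proof.
move=> n2; have n0 : 0 < n%:R :> R by rewrite ltr0n; lia.
have L0 : 0 < lnR n by have := ln_ge_half n2; lra.
rewrite -[X in _ <= 4 * X](@lnK R) ?posrE//.
have -> : expR (lnR n) = expR (lnR n / 2) ^+ 2 by rewrite expr2 -expRD; congr expR; field.
have := expR_ge1Dx (lnR n / 2); move: L0; move: (ln _) (expR _) => l y l0 ly.
nra.
Qed.

Lemma sqr_expR_ge T : 0 <= T -> T ^+ 2 <= 4 * expR T.
Proof.
move=> T0; have -> : expR T = expR (T / 2) ^+ 2 by rewrite expr2 -expRD; congr expR; field.
have := expR_ge1Dx (T / 2); move: (expR _) => y Ty; nra.
Qed.

Lemma ceil_nat L : 0 < L -> exists M, [/\ (0 < M)%N, L <= M%:R & M%:R <= L + 1].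
Proof.
move=> L0; exists (Num.truncn L).+1; split => //; first by rewrite ltW// truncnS_gt.
by rewrite -natr1 lerD2r truncn_le ltW.
Qed.

(** The summand [1 / C] of [T] pays for [S]; the 128 leaves a factor
    [exp (- 128 ln n) <= 1 / 24]. *)
Lemma card_exp_le S n C T : (0 < S)%N -> (2 <= n)%N -> 0 < C -> T = C^-1 + 128 ->
  C * ln S%:R <= lnR n ->
  S%:R * (2 * expR (- (T * lnR n)) + expR (- (T * lnR n))) <= 1 / 8.
Proof.
move=> S0 n2 C0 -> CL; have S0' : 0 < S%:R :> R by rewrite ltr0n.
have L2 := ln_ge_half n2; set L := lnR n in CL L2 *.
have SL : S%:R <= expR (C^-1 * L).
  by rewrite -[leLHS](@lnK R) ?posrE// ler_expR -ler_pdivrMl ?invr_gt0// invrK.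
have E : expR (- ((C^-1 + 128) * L)) = expR (- (C^-1 * L)) * expR (- (128 * L)).
  by rewrite -expRD; congr expR; ring.
have e1 : S%:R * expR (- (C^-1 * L)) <= 1 by rewrite expRN ler_pdivrMr ?expR_gt0// mul1r.
have e2 : 0 <= S%:R * expR (- (C^-1 * L)) by rewrite mulr_ge0 ?expR_ge0 ?ler0n.
have e3 : expR (- (128 * L)) <= 1 / 24.
  apply: (@le_trans _ _ (expR (- 64))); first by rewrite ler_expR; lra.
  rewrite expRN div1r lef_pV2 ?posrE ?expR_gt0//.
  have := expR_ge1Dx (64 : R); lra.
rewrite E; have e4 := expR_ge0 (- (128 * L)).
rewrite (_ : S%:R * (_ + _) = 3 * (S%:R * expR (- (C^-1 * L))) * expR (- (128 * L))); last by ring.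
move: e1 e2 e3 e4; move: (S%:R * expR _) (expR (- (128 * L))) => x y x1 x0 y1 y0; nra.
Qed.

(** From [T >= 128] on, [exp T >= T ^ 2 / 4] yields [exp T >= 32 T]. *)
Lemma kappa_le T : 128 <= T -> 64 * (expR (- T) / 2) * T <= 1.
Proof.
move=> T1; have T0 : 0 <= T by lra.
have := sqr_expR_ge T0; rewrite expRN => ET.
have e0 := expR_gt0 T.
rewrite (_ : 64 * _ * T = (32 * T) / expR T); last by field; rewrite gt_eqF.
rewrite ler_pdivrMr// mul1r; nra.
Qed.

Lemma kappa_small T : 128 <= T -> expR (- T) / 2 <= 1 / 8.
Proof.
move=> T1; have := kappa_le T1; have := expR_gt0 (- T); move: (expR _) => k k0; nra.
Qed.

(** With [theta = exp T] the moments gain [exp (- 4 M T)], and the factor [exp (- T) / 2] in [M0] is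
    chosen so that the exponential loses no more than a factor [n]. *)
Lemma chi_bound n M T (w a M0 : R) : (0 < n)%N -> 1 <= 2 * T -> 0 < a ->
  M0 = expR (- T) / 2 * lnR n / n%:R -> w ^+ 2 <= M0 * a -> 0 <= lnR n -> lnR n <= M%:R ->
  4 * expR T ^- (4 * M) * expR (expR T * (n%:R * w ^+ 2 * (2 / a))) <=
  (2 * expR (- (T * lnR n))) ^+ 2.
Proof.
move=> n0 T1 a0 M0E wa L0 LM; have n0' : 0 < n%:R :> R by rewrite ltr0n.
have T0 : 0 <= T by lra.
have -> : expR T ^- (4 * M) = expR (- ((4 * M)%:R * T)) by rewrite expRN expRM_natl.
have -> : (2 * expR (- (T * lnR n))) ^+ 2 = 4 * expR (2 * - (T * lnR n)).
  by rewrite exprMn expRM_natl; ring.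
rewrite -mulrA ler_pM2l// -expRD ler_expR.
have h1 : expR T * (n%:R * w ^+ 2 * (2 / a)) <= lnR n.
  apply: (@le_trans _ _ (expR T * (n%:R * (M0 * a) * (2 / a)))).
    by rewrite ler_wpM2l ?expR_ge0// ler_wpM2r ?divr_ge0 ?(ltW a0)// ler_wpM2l ?ler0n.
  rewrite M0E expRN le_eqVlt; apply/orP; left; apply/eqP; field.
  by rewrite !gt_eqF ?expR_gt0.
have h2 : T * lnR n <= T * M%:R by rewrite ler_wpM2l.
have h3 : lnR n <= 2 * (T * lnR n) by rewrite mulrA ler_peMl.
rewrite natrM; move: h1 h2 h3; move: (expR T * _) (ln _) (M%:R) => x l m h1 h2 h3.
rewrite mulrN.
rewrite (_ : - (4 * m * T) = - (4 * (T * m))); last by ring.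
lra.
Qed.

(** Chernoff exponent at [lambda = 1 / (2 M0)]: the mean costs at most [1 / (32 M0)] against a gain
    of [1 / (8 M0)], and [T ln n <= 1 / (16 M0)] because [ln n ^ 2 <= 4 n]. *)
Lemma tail_exponent n T (M0 s : R) : (2 <= n)%N -> 128 <= T ->
  M0 = expR (- T) / 2 * lnR n / n%:R -> s <= 1 / 64 ->
  2 * s / M0 - (2 * M0)^-1 / 4 <= - (T * lnR n).
Proof.
move=> n2 T1 M0E s1; have n0 : 0 < n%:R :> R by rewrite ltr0n; lia.
have L2 := ln_ge_half n2; have LL := ln_sqr_le n2; have kT := kappa_le T1.
have L0 : 0 < lnR n by lra.
have e0 := expR_gt0 (- T).
have M00 : 0 < M0 by rewrite M0E divr_gt0// mulr_gt0// divr_gt0.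
have key : T * lnR n * (16 * M0) <= 1.
  rewrite M0E (_ : _ * (16 * _) = (16 * (expR (- T) / 2) * T) * (lnR n ^+ 2 / n%:R)); last first.
    by field; rewrite gt_eqF.
  have h : lnR n ^+ 2 / n%:R <= 4 :> R by rewrite ler_pdivrMr.
  have h0 : 0 <= lnR n ^+ 2 / n%:R :> R by rewrite divr_ge0 ?sqr_ge0 ?ltW.
  have z0 : 0 <= 16 * (expR (- T) / 2) * T by rewrite !mulr_ge0 ?(ltW e0)//; lra.
  move: kT; rewrite (_ : 64 * _ * T = 4 * (16 * (expR (- T) / 2) * T)); last by ring.
  move: h h0 z0; move: (_ / n%:R) (16 * _ * T) => x y; nra.
rewrite -(ler_pM2r M00) mulrBl mulfVK ?gt_eqF//.
rewrite (_ : (2 * M0)^-1 / 4 * M0 = 1 / 8); last by field; rewrite gt_eqF.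
rewrite mulNr; move: key; rewrite (_ : _ * (16 * M0) = 16 * (T * lnR n * M0)); last by ring.
move: (T * _ * M0) => z; lra.
Qed.

(** [e sqrt (M0 p / e)] is [sqrt kappa * ln n] times the square root in the rate, and
    [M <= ln n + 1 <= 3 ln n] cancels the logarithm. *)
Lemma rate_term n M (e p c kappa M0 : R) : (2 <= n)%N -> 0 < p -> 1 <= e -> 0 <= c ->
  0 < kappa <= 1 -> M0 = kappa * lnR n / n%:R -> (0 < M)%N -> M%:R <= lnR n + 1 ->
  c / 3 * (Num.sqrt kappa / 3) * Num.min p (Num.sqrt (e * p / (n%:R * lnR n))) <=
  e * (Num.min (p / e) (Num.sqrt (M0 * (p / e)) / M%:R) * (c / 3)).
Proof.
move=> n2 p0 e1 c0 /andP[k0 k1] M0E M1 ML.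
have n0 : 0 < n%:R :> R by rewrite ltr0n; lia.
have L2 := ln_ge_half n2; have L0 : 0 < lnR n by lra.
have e0 : 0 < e by lra.
have m0 : 0 < M%:R :> R by rewrite ltr0n.
rewrite [leRHS]mulrA [leRHS]mulrC -[leLHS]mulrA ler_wpM2l ?divr_ge0//.
set y := Num.sqrt (M0 * _) / _; set z := Num.sqrt (e * p / _).
have z0 : 0 <= z by exact: sqrtr_ge0.
have s1 : Num.sqrt kappa <= 1 by rewrite -sqrtr1 ler_sqrt.
have s0 : 0 <= Num.sqrt kappa by exact: sqrtr_ge0.
have ye : Num.sqrt kappa / 3 * z <= e * y.
  have zE : e * Num.sqrt (M0 * (p / e)) = Num.sqrt kappa * (lnR n * z).
    apply/eqP; rewrite -(@eqrXn2 _ 2)// ?mulr_ge0 ?sqrtr_ge0 ?(ltW e0) ?(ltW L0)//.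
    have M00 : 0 < M0 by rewrite M0E divr_gt0// mulr_gt0.
    rewrite !exprMn !sqr_sqrtr ?mulr_ge0 ?invr_ge0 ?mulr_ge0 ?(ltW k0) ?(ltW e0) ?(ltW p0) ?(ltW n0) ?(ltW L0) ?(ltW M00)//.
    by rewrite M0E; apply/eqP; field; rewrite !gt_eqF.
  have LM : 3^-1 <= lnR n / M%:R by rewrite ler_pdivlMr//; lra.
  rewrite /y [leRHS]mulrA zE (_ : _ / M%:R = Num.sqrt kappa * (lnR n / M%:R * z)); last by field; rewrite gt_eqF.
  by rewrite -mulrA; apply: ler_wpM2l => //; exact: ler_wpM2r.
have -> : e * Num.min (p / e) y = Num.min p (e * y).
  by rewrite minr_pMr ?(ltW e0)// [e * (p / e)]mulrCA divff ?mulr1// gt_eqF.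
rewrite le_min; apply/andP; split.
  apply: (@le_trans _ _ (Num.sqrt kappa / 3 * p)).
    by rewrite ler_wpM2l ?divr_ge0// ge_min lexx.
  by rewrite ler_piMl ?(ltW p0)//; lra.
by apply: le_trans ye; rewrite ler_wpM2l ?divr_ge0// ge_min lexx orbT.
Qed.

(** The two terms of the hypothesis on [P] dominate the two parts of the standard deviation: the
    first stems from half-widths [sqrt (M0 tau)], the second from up to [S] half-widths of order
    [M0]. *)
Lemma variance_sum S n (e M0 kappa th r C' : R) : (2 <= n)%N -> 1 <= e -> 0 < kappa <= 1 ->
  M0 = kappa * lnR n / n%:R -> e * th <= 1 -> 0 < C' ->
  C' * (Num.sqrt (e * lnR n / n%:R) + e * Num.sqrt S%:R * lnR n / n%:R) <= r ->
  e ^+ 2 * (M0 * th + S%:R * M0 ^+ 2) <= (r / C') ^+ 2.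
Proof.
move=> n2 e1 /andP[k0 k1] M0E th1 C0 rC.
have n0 : 0 < n%:R :> R by rewrite ltr0n; lia.
have L2 := ln_ge_half n2; have L0 : 0 < lnR n by lra.
have e0 : 0 < e by lra.
pose X := e * lnR n / n%:R.
have X0 : 0 < X by rewrite divr_gt0// mulr_gt0.
have eM : e * M0 <= X.
  by rewrite M0E /X mulrA [e * (_ * _)]mulrCA ler_pM2r ?invr_gt0// ler_piMl ?mulr_ge0 ?(ltW e0) ?(ltW L0).
have M00 : 0 < M0 by rewrite M0E divr_gt0// mulr_gt0.
have eM0 : 0 < e * M0 by rewrite mulr_gt0.
apply: (@le_trans _ _ ((Num.sqrt X + Num.sqrt S%:R * X) ^+ 2)); last first.
  have s1 : 0 <= Num.sqrt X + Num.sqrt S%:R * X by apply: addr_ge0; [exact: sqrtr_ge0|apply: mulr_ge0; [exact: sqrtr_ge0|exact: ltW]].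
  have s2 : Num.sqrt X + Num.sqrt S%:R * X <= r / C'.
    rewrite ler_pdivlMr// mulrC (_ : Num.sqrt S%:R * X = e * Num.sqrt S%:R * lnR n / n%:R)//.
    by rewrite /X; ring.
  by rewrite ler_pXn2r ?nnegrE ?(le_trans s1 s2).
have sS : Num.sqrt S%:R ^+ 2 = S%:R :> R by rewrite sqr_sqrtr ?ler0n.
have sX : Num.sqrt X ^+ 2 = X by rewrite sqr_sqrtr// ltW.
apply: (@le_trans _ _ (X + S%:R * X ^+ 2)).
  rewrite mulrDr lerD//.
    rewrite (_ : e ^+ 2 * (M0 * th) = e * M0 * (e * th)); last by ring.
    by apply: le_trans eM; rewrite ler_piMr// ltW.
  rewrite mulrCA -exprMn ler_wpM2l ?ler0n// ler_pXn2r// nnegrE ltW//.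
rewrite sqrrD sX (exprMn _ (Num.sqrt S%:R : R)) sS lerD2r lerDl mulrn_wge0//.
by apply: mulr_ge0; [exact: sqrtr_ge0|apply: mulr_ge0; [exact: sqrtr_ge0|exact: ltW]].
Qed.

End numeric_bounds.

Section priors.
Context {R : realType}.

Lemma variance_le N (w g : 'I_N -> R) (c b : R) :
  (forall t, 0 <= w t) -> \sum_t w t = 1 -> (forall t, `|g t - c| <= b) ->
  \sum_t w t * (g t - \sum_t' w t' * g t') ^+ 2 <= b ^+ 2.
Proof.
move=> w0 w1 gc; pose E := \sum_t w t * g t; rewrite -/E.
have cE : \sum_t w t * (g t - c) = E - c.
  under eq_bigr do rewrite mulrBr.
  by rewrite sumrB -mulr_suml w1 mul1r.
have -> : \sum_t w t * (g t - E) ^+ 2 = \sum_t w t * (g t - c) ^+ 2 - (E - c) ^+ 2.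
  transitivity (\sum_t w t * (g t - c) ^+ 2 - 2 * (E - c) * (\sum_t w t * (g t - c))
      + (\sum_t w t) * (E - c) ^+ 2); last by rewrite cE w1; ring.
  rewrite mulr_sumr mulr_suml -sumrB -big_split/=; apply: eq_bigr => t _; ring.
rewrite lerBlDr; apply: (@le_trans _ _ (b ^+ 2)); last by rewrite lerDl sqr_ge0.
apply: (@le_trans _ _ (\sum_t w t * b ^+ 2)); last by rewrite -mulr_suml w1 mul1r.
apply: ler_sum => t _; rewrite ler_wpM2l//.
have b0 : 0 <= b by apply: le_trans (gc t).
rewrite -[X in X ^+ 2 <= _]opprK -[leLHS]ger0_norm ?sqr_ge0// normrX normrN opprB -normrN opprB.
by rewrite ler_pXn2r// nnegrE.
Qed.

Lemma dist_maxr0 (x y : R) : `|Num.max x 0 - Num.max y 0| <= `|x - y|.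
Proof.
case: (leP x 0) => x0; case: (leP y 0) => y0.
- by rewrite subrr normr0 normr_ge0.
- by rewrite sub0r normrN distrC !ger0_norm; lra.
- by rewrite subr0 !ger0_norm; lra.
- by [].
Qed.

(* The two matching laws of a single coordinate of [Q], on the support
   [center + width * node]. *)
Record prior N := Prior {
  law0 : 'I_N -> R; law1 : 'I_N -> R; node : 'I_N -> R; center : R; width : R }.

Definition point N (d : prior N) t := center d + width d * node d t.

Definition admissible M (c M0 tau : R) (d : prior (16 * M)) :=
  let f t := Num.max (tau - point d t) 0 in
  [/\ forall t, 0 <= law0 d t, forall t, 0 <= law1 d t, \sum_t law0 d t = 1 & \sum_t law1 d t = 1] /\
  [/\ forall t, `|node d t| <= 1, 0 < width d, width d <= center d & width d ^+ 2 <= M0 * center d] /\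
  [/\ width d ^+ 2 <= M0 * tau + M0 ^+ 2, center d <= tau + M0,
     forall j, (j < 4 * M)%N -> \sum_t law0 d t * node d t ^+ j = \sum_t law1 d t * node d t ^+ j &
     \sum_t law0 d t * f t + Num.min tau (Num.sqrt (M0 * tau) / M%:R) * (c / 3) <= \sum_t law1 d t * f t] /\
  [/\ \sum_t law0 d t * point d t = tau, \sum_t law1 d t * point d t = tau,
     \sum_t law0 d t * expR (point d t / (2 * M0)) <= expR (2 * tau / M0) &
     \sum_t law1 d t * expR (point d t / (2 * M0)) <= expR (2 * tau / M0)].

Lemma point_ge0 N (d : prior N) t : `|node d t| <= 1 -> 0 < width d -> width d <= center d ->
  0 <= point d t.
Proof.
rewrite ler_norml => /andP[x1 _] w0 wa; rewrite -lerBlDl sub0r.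
by apply: (@le_trans _ _ (- width d)); rewrite ?lerN2// -mulrN1 ler_pM2l.
Qed.

End priors.

(** * The lower bound for a fixed [P] *)

Section lower_bound.
Context {R : realType} (c C : R).
Hypotheses (c0 : 0 < c) (C0 : 0 < C).
Hypothesis priors : forall (M : nat) (M0 tau : R), (0 < M)%N -> 0 < M0 -> 0 < tau ->
  exists d : prior (16 * M), admissible c M0 tau d.

Let T : R := C^-1 + 128.
Let kappa : R := expR (- T) / 2.
Let c2 : R := c / 3 * (Num.sqrt kappa / 3).
(** The 260 makes every [r j] at most [rate / 130]; [1536 = 12 * 128] makes the standard deviation
    at most a twelfth of the gap [c2 * (rate / 128)]. *)
Let C' : R := 260 + 1536 / c2.

Let kappa01 : 0 < kappa <= 1.
Proof.
have T0 : 0 <= T by rewrite addr_ge0// invr_ge0 ltW.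
have : expR (- T) <= 1 by rewrite -expR0 ler_expR oppr_le0.
by have := expR_gt0 (- T); rewrite /kappa; move: (expR _) => x x0 x1; apply/andP; split; lra.
Qed.

Let c2_gt0 : 0 < c2.
Proof. by have /andP[k0 _] := kappa01; rewrite mulr_gt0 ?divr_gt0 ?sqrtr_gt0. Qed.

Let C'_gt0 : 0 < C'.
Proof. by apply: addr_gt0; [rewrite ltr0n|apply: divr_gt0; [rewrite ltr0n|exact: c2_gt0]]. Qed.

Variables (eps : R) (S n : nat) (P : S.-tuple R).
Hypotheses (eps0 : 0 <= eps) (S2 : (2 <= S)%N) (n2 : (2 <= n)%N).
Hypotheses (CL : C * ln S%:R <= ln n%:R) (HP : distributions S P).
Let e := expR eps.
Let L : R := ln n%:R.
Let r j : R := Num.min (tnth P j) (Num.sqrt (e * tnth P j / (n%:R * L))).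
Let rate := rate_sum n eps P.
Hypothesis large : C' * (Num.sqrt (e * L / n%:R) + e * Num.sqrt S%:R * L / n%:R) <= rate.

Let p0 j : 0 <= tnth P j. Proof. exact: HP.1. Qed.

Let e1 : 1 <= e. Proof. by rewrite -expR0 ler_expR. Qed.

Let L2 : 1 / 2 <= L. Proof. exact: ln_ge_half. Qed.

Let n_gt0 : 0 < n%:R :> R. Proof. by rewrite ltr0n (leq_trans _ n2). Qed.

Let r0 j : 0 <= r j. Proof. by rewrite le_min p0 sqrtr_ge0. Qed.

Let rate_gt0 : 0 < rate.
Proof.
apply: lt_le_trans large; rewrite mulr_gt0// ltr_pwDl//.
  rewrite sqrtr_gt0; apply: divr_gt0 => //; apply: mulr_gt0; [exact: expR_gt0|exact: lt_le_trans L2].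
rewrite divr_ge0 ?(ltW n_gt0)// mulr_ge0 ?mulr_ge0 ?expR_ge0 ?sqrtr_ge0//.
exact: le_trans L2.
Qed.

(** Six halvings lose [65 rho], half of the rate. *)
Let rho := rate / 130.

Let r_rho j : 0 <= r j <= rho.
Proof.
have e0 : 0 < e by exact: expR_gt0.
have L0 : 0 < L by exact: lt_le_trans L2.
have p1 : tnth P j <= 1 by rewrite -HP.2 (bigD1 j)//= lerDl sumr_ge0.
rewrite r0/=; apply: (@le_trans _ _ (Num.sqrt (4 * (e * L / n%:R)))).
  rewrite ge_min; apply/orP; right; rewrite ler_sqrt; last by rewrite !mulr_ge0 ?invr_ge0 ?(ltW e0) ?(ltW L0) ?(ltW n_gt0).
  rewrite ler_pdivrMr ?mulr_gt0//.
  rewrite (_ : 4 * _ * _ = e * (4 * L ^+ 2)); last by field; rewrite gt_eqF.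
  rewrite ler_pM2l//; apply: (le_trans p1); have := L2; move: (L) => l l2; nra.
rewrite sqrtrM// (_ : 4 = 2 ^+ 2); last by ring.
rewrite sqrtr_sqr ger0_norm// /rho ler_pdivlMr//.
have : 260 * Num.sqrt (e * L / n%:R) <= rate.
  apply: le_trans large; apply: ler_pM; [by rewrite ler0n|exact: sqrtr_ge0| |].
    by rewrite /C' lerDl; apply: divr_ge0; [rewrite ler0n|exact: ltW c2_gt0].
  rewrite lerDl divr_ge0 ?(ltW n_gt0)// mulr_ge0 ?mulr_ge0 ?sqrtr_ge0 ?(ltW e0) ?(ltW L0)//.
lra.
Qed.

(* Halving the support of [P] once leaves a coordinate [m] outside [A0] whose
   mass in [P] is beaten by the leftover mass of [Q]; halving it five more times
   makes [A] light enough for the leftover to stay above that threshold. *)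
Let active : exists (A0 A : {set 'I_S}) (m : 'I_S),
  [/\ m \notin A0, A \subset A0, forall i, i \in A -> 0 < tnth P i &
   [/\ \sum_(i in A0) tnth P i <= 1 / 2, 0 < \sum_(i in A0) tnth P i,
      tnth P m + \sum_(i in A0) tnth P i <= 1,
      32 * \sum_(i in A) tnth P i <= \sum_(i in A0) tnth P i & rate / 128 <= \sum_(i in A) r i]].
Proof.
pose F : {set 'I_S} := finset.finset (fun i => 0 < tnth P i).
have sumF (f : 'I_S -> R) : (forall i, tnth P i = 0 -> f i = 0) -> \sum_(i in F) f i = \sum_i f i.
  move=> f0; rewrite [RHS](bigID (fun i => i \in F))/= [X in _ + X]big1 ?addr0// => i; rewrite inE -leNgt => pi0.
  by apply: f0; apply/eqP; rewrite eq_le pi0 p0.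
have pF : \sum_(i in F) tnth P i = 1 by rewrite sumF ?HP.2.
have rF : \sum_(i in F) r i = rate.
  by rewrite sumF// => i pi; rewrite /r pi min_l// mulr0 mul0r sqrtr0.
have pF0 : 0 < \sum_(i in F) tnth P i by rewrite pF.
have [A0 A0F [[m mF mA0] [pA0 rA0]]] := @split_half R S F (tnth P) r rho p0 r_rho pF0.
have rho0 : 0 <= rho by rewrite divr_ge0 ?(ltW rate_gt0).
have [A AA0 [pA rA]] := @split_iter R S A0 (tnth P) r rho 5 p0 rho0 r_rho.
exists A0, A, m; split => //.
- move=> i iA; have : i \in F by apply: (fintype.subsetP A0F); exact: (fintype.subsetP AA0).
  by rewrite inE.
- have rr : rate <= 64 * \sum_(i in A) r i + 65 * rho.
    move: rA0; rewrite rF => /le_trans; apply; move: rA; move: (\sum_(i in A0) _) (\sum_(i in A) _) => x y.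
    by rewrite (_ : 2 ^+ 5 = 32); [lra|ring].
  have r128 : rate / 128 <= \sum_(i in A) r i by move: rr; rewrite /rho; lra.
  split => //.
  + by move: pA0; rewrite pF.
  + apply: (@lt_le_trans _ _ (\sum_(i in A) r i)); first by apply: lt_le_trans r128; rewrite divr_gt0.
    apply: (@le_trans _ _ (\sum_(i in A) tnth P i)).
      by apply: ler_sum => i _; rewrite ge_min lexx.
    rewrite [leRHS](bigID (fun i => i \in A))/=.
    have -> : \sum_(i in A0 | i \in A) tnth P i = \sum_(i in A) tnth P i.
      by apply: eq_bigl => i; rewrite andb_idl//; exact: (fintype.subsetP AA0).
    by rewrite lerDl sumr_ge0.
  + have E : \sum_(i < S) tnth P i = tnth P m + \sum_(i < S | i != m) tnth P i by rewrite (bigD1 m).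
    rewrite -[leRHS]HP.2 E lerD2l [leRHS](bigID (fun i => i \in A0))/=.
    have -> : \sum_(i < S | (i != m) && (i \in A0)) tnth P i = \sum_(i in A0) tnth P i.
      apply: eq_bigl => i; rewrite andb_idl// => iA0.
      by apply: contraNneq mA0 => <-.
    by rewrite lerDl sumr_ge0.
  + by move: pA; rewrite (_ : 2 ^+ 5 = 32)//; ring.
Qed.

Let rate_Delta (x : R) : 0 <= x -> (x / C') ^+ 2 <= (c2 * (x / 128)) ^+ 2 / 128.
Proof.
move=> x0; have c2p := c2_gt0; have C'p := C'_gt0.
pose y := c2 * (x / 128).
have y0 : 0 <= y by apply: mulr_ge0 (ltW c2p) _; apply: divr_ge0 x0 _; rewrite ler0n.
have xy : x / C' <= y / 12.
  rewrite ler_pdivrMr//; have -> : y / 12 * C' = x + 65 / 384 * (c2 * x).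
    rewrite /y /C'; move: (c2) c2p => k k0; field; by rewrite gt_eqF.
  rewrite lerDl; apply: mulr_ge0; last exact: mulr_ge0 (ltW c2p) x0.
  by apply: divr_ge0; exact: ler0n.
rewrite -/y; move: xy y0; have : 0 <= x / C' by apply: divr_ge0 x0 (ltW C'p).
by move: (x / C') (y) => u v; nra.
Qed.

Let sum_if (A : {set 'I_S}) (f : 'I_S -> R) : \sum_i (if i \in A then f i else 0) = \sum_(i in A) f i.
Proof. by rewrite -big_mkcond. Qed.

Lemma minimax_lower_bound : (((c2 / 128) ^+ 2 / 128 * rate ^+ 2)%:E <= minimax_risk n eps P)%E.
Proof.
have e0 : 0 < e by exact: expR_gt0.
have L0 : 0 < L by exact: lt_le_trans L2.
have n1 : (0 < n)%N by rewrite (leq_trans _ n2).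
have T128 : 128 <= T by rewrite /T lerDr invr_ge0 ltW.
have T1 : 1 <= 2 * T by move: T128; move: (T) => x xT; lra.
have [M [M_gt0 LM ML]] := ceil_nat L0.
pose M0 : R := kappa * L / n%:R.
have /andP[k0 k1] := kappa01.
have M00 : 0 < M0 by rewrite divr_gt0// mulr_gt0.
have M08 : M0 <= 1 / 8.
  apply: (@le_trans _ _ kappa).
    rewrite /M0 -mulrA ler_piMr ?(ltW k0)// ler_pdivrMr// mul1r.
    by rewrite ltW// ln_sublinear.
  exact: kappa_small.
have [A0 [A [m [mA0 AA0 Ppos [pA0 pA0_gt0 pm pA rA]]]]] := active.
have mA : m \notin A by apply: contra mA0 => /(fintype.subsetP AA0).
pose tau i := tnth P i / e.
have prior_ex i : exists d : prior (16 * M), i \in A -> admissible c M0 (tau i) d.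
  have [iA|iA] := boolP (i \in A); last first.
    by exists (Prior (fun=> 0) (fun=> 0) (fun=> 0) 0 0).
  have [d dP] := priors M_gt0 M00 (divr_gt0 (Ppos i iA) e0).
  by exists d.
have [d dP] := boolp.choice prior_ex.
(* Outside [A] the coordinate of [Q] is 0 under both priors; a common weight makes the exchange
   there free. *)
pose unif : 'I_(16 * M) -> R := fun=> (16 * M)%:R^-1.
pose mu i t := if i \in A then law0 (d i) t else unif t.
pose nu i t := if i \in A then law1 (d i) t else unif t.
pose q i t := if i \in A then point (d i) t else 0.
pose g i t := if i == m then 0 else Num.max (tnth P i - e * q i t) 0.
have q0 i t : 0 <= q i t.
  rewrite /q; case: ifP => // iA; have [_ [[x1 w0 wa _] _]] := dP i iA.
  exact: point_ge0.
have qm t : q m t = 0 by rewrite /q (negPf mA).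
have unif1 : \sum_t unif t = 1.
  rewrite sumr_const card_ord -[_ *+ _]mulr_natr mulVf// pnatr_eq0 -lt0n muln_gt0 M_gt0 //.
have unif0 t : 0 <= unif t by rewrite invr_ge0 ler0n.
have muA i : i \in A -> mu i = law0 (d i) by move=> iA; apply/funext => t; rewrite /mu iA.
have nuA i : i \in A -> nu i = law1 (d i) by move=> iA; apply/funext => t; rewrite /nu iA.
have muN i : i \notin A -> mu i = unif by move=> /negPf iA; apply/funext => t; rewrite /mu iA.
have nuN i : i \notin A -> nu i = unif by move=> /negPf iA; apply/funext => t; rewrite /nu iA.
have qA i t : i \in A -> q i t = point (d i) t by rewrite /q => ->.
have qN i t : i \notin A -> q i t = 0 by rewrite /q => /negPf ->.
have hmu : is_weight mu.
  move=> i; have [iA|iA] := boolP (i \in A); last by rewrite muN.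
  by rewrite muA//; have [[]] := dP i iA.
have hnu : is_weight nu.
  move=> i; have [iA|iA] := boolP (i \in A); last by rewrite nuN.
  by rewrite nuA//; have [[]] := dP i iA.
(* Below [cut], coordinate [m] does not contribute to [d_eps]: [e * total] is at most the mass of
   [A0], hence at most [1 - p_m <= e - p_m]. *)
pose cut := (\sum_(i in A0) tnth P i) / e.
have cut0 : 0 < cut by rewrite divr_gt0.
have cut2 : cut <= 1 / 2.
  by rewrite /cut ler_pdivrMr// (le_trans pA0)// ler_peMr.
pose Delta := c2 * (rate / 128).
have D0 : 0 < Delta by rewrite mulr_gt0// divr_gt0.
have sumtau : \sum_(i in A) tau i = (\sum_(i in A) tnth P i) / e by rewrite mulr_suml.
have tau_cut : \sum_(i in A) tau i <= cut / 32.
  rewrite sumtau /cut mulrAC ler_pM2r ?invr_gt0// ler_pdivlMr// mulrC //.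
have tau0 i : 0 <= tau i by rewrite divr_ge0// ltW.
have tau64 : \sum_(i in A) tau i <= 1 / 64.
  by apply: (le_trans tau_cut); rewrite ler_pdivrMr//; apply: (le_trans cut2); lra.
have eq_e i : tnth P i = e * tau i by rewrite /tau mulrC divfK// gt_eqF.
have tau_le (B : {set 'I_S}) : e * \sum_(i in B) tau i = \sum_(i in B) tnth P i.
  by rewrite mulr_sumr; apply: eq_bigr => i _; rewrite -eq_e.
have dE u : total q u <= cut -> hockey_stick eps P (law m q u) = \sum_i g i (u i).
  move=> tot; rewrite /hockey_stick -/e; apply: eq_bigr => i _; rewrite /g.
  have tot4 : total q u <= 3 / 4 by apply: (le_trans tot); apply: (le_trans cut2); lra.
  rewrite /law tot4 tnth_mktuple; have [->|//] := eqVneq i m.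
  apply/max_idPr; rewrite subr_le0 mulrBr mulr1 lerBrDr.
  apply: (@le_trans _ _ 1) => //; apply: le_trans pm; rewrite lerD2l.
  by move: tot; rewrite /cut ler_pdivlMr// mulrC.
have im i : i \in A -> (i == m) = false.
  by move=> iA; apply/negbTE; apply: contraNneq mA => <-.
have gA i t : i \in A -> g i t = e * Num.max (tau i - point (d i) t) 0.
  by move=> iA; rewrite /g im// qA// maxr_pMr ?(ltW e0)// mulr0 mulrBr -eq_e.
have gap : \sum_i \sum_t mu i t * g i t + Delta <= \sum_i \sum_t nu i t * g i t.
  have rD : Delta <= \sum_i (if i \in A then c2 * r i else 0).
    by rewrite sum_if -mulr_sumr /Delta ler_pM2l.
  apply: (@le_trans _ _ (\sum_i \sum_t mu i t * g i t + \sum_i (if i \in A then c2 * r i else 0))).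
    by rewrite lerD2l.
  rewrite -big_split/=; apply: ler_sum => i _; have [iA|iA] := boolP (i \in A); last first.
    by rewrite addr0 (muN i iA) (nuN i iA).
  rewrite (muA i iA) (nuA i iA).
  under eq_bigr do rewrite (gA _ _ iA) mulrCA; under [leRHS]eq_bigr do rewrite (gA _ _ iA) mulrCA.
  rewrite -!mulr_sumr; have [_ [_ [[_ _ _ sig] _]]] := dP i iA.
  apply: (@le_trans _ _ (e * (\sum_t law0 (d i) t * Num.max (tau i - point (d i) t) 0 +
    Num.min (tau i) (Num.sqrt (M0 * tau i) / M%:R) * (c / 3)))); last by rewrite ler_pM2l.
  rewrite mulrDr lerD2l.
  exact: (rate_term n2 (Ppos i iA) e1 (ltW c0) kappa01 erefl M_gt0 ML).
have var_i (w : 'I_S -> 'I_(16 * M) -> R) i : is_weight w ->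
    \sum_t w i t * (g i t - \sum_t' w i t' * g i t') ^+ 2 <=
    (if i \in A then e ^+ 2 * (M0 * tau i + M0 ^+ 2) else 0).
  move=> hw; have [iA|iA] := boolP (i \in A); last first.
    apply: le_trans (@variance_le _ _ (w i) (g i) (if i == m then 0 else Num.max (tnth P i) 0) 0 (hw i).1 (hw i).2 _) _.
      by move=> t; rewrite /g qN// mulr0 subr0; case: ifP => _; rewrite subrr normr0.
    by rewrite expr0n.
  have [_ [[x1 w0 wa _] [[ww _ _ _] _]]] := dP i iA.
  apply: le_trans (@variance_le _ _ (w i) (g i) (e * Num.max (tau i - center (d i)) 0) (e * width (d i)) (hw i).1 (hw i).2 _) _.
    move=> t; rewrite gA// -mulrBr normrM gtr0_norm// ler_pM2l//.
    apply: le_trans (dist_maxr0 _ _) _.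
    rewrite (_ : _ - _ = - (width (d i) * node (d i) t)); last by rewrite /point; ring.
    by rewrite normrN normrM gtr0_norm// ler_piMr// ltW.
  by rewrite exprMn ler_pM2l// exprn_gt0.
have bounds w : w = mu \/ w = nu ->
    \sum_i \sum_t w i t * (g i t - \sum_t' w i t' * g i t') ^+ 2 <= Delta ^+ 2 / 128 /\
    \sum_i \sum_t w i t * q i t <= cut / 32.
  move=> wE; have hw : is_weight w by case: wE => ->.
  split.
    apply: (@le_trans _ _ (\sum_i (if i \in A then e ^+ 2 * (M0 * tau i + M0 ^+ 2) else 0))).
      by apply: ler_sum => i _; exact: var_i.
    rewrite sum_if -mulr_sumr big_split/= -mulr_sumr sumr_const.
    apply: (@le_trans _ _ (e ^+ 2 * (M0 * (\sum_(i in A) tau i) + S%:R * M0 ^+ 2))).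
      rewrite ler_pM2l ?exprn_gt0// lerD2l -[leLHS]mulr_natl ler_wpM2r ?sqr_ge0// ler_nat.
      by rewrite -[X in (_ <= X)%N]card_ord max_card.
    apply: (@le_trans _ _ ((rate / C') ^+ 2)).
      apply: (@variance_sum R S n e M0 kappa _ rate C') => //.
      rewrite tau_le; apply: (@le_trans _ _ (\sum_i tnth P i)); last by rewrite HP.2.
      by rewrite [leRHS](bigID (fun i => i \in A))/= lerDl sumr_ge0.
    exact: rate_Delta (ltW rate_gt0).
  have -> : \sum_i \sum_t w i t * q i t = \sum_i (if i \in A then tau i else 0).
    apply: eq_bigr => i _; have [iA|iA] := boolP (i \in A); last first.
      by rewrite big1// => t _; rewrite qN// mulr0.
    have [_ [_ [_ [m0 m1 _ _]]]] := dP i iA; under eq_bigr do rewrite (qA _ _ iA).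
    by case: wE => ->; rewrite ?(muA i iA) ?(nuA i iA).
  by rewrite sum_if.
have tv E : expect nu (fun u => prob n (law m q u) E) -
     expect mu (fun u => prob n (law m q u) E) <= 1 / 8.
  pose eta : R := 2 * expR (- (T * L)).
  pose th i := if i \in A then 2 * tau i / M0 else 0.
  have eta0 : 0 < eta by rewrite mulr_gt0 ?expR_gt0.
  have br s (u : {ffun 'I_S -> 'I_(16 * M)}) : \sum_(j | j != s) q j (u j) <= 1 / 4 ->
      \sum_t (nu s t - mu s t) * prob n (law m q (update u s t)) E <= eta.
    move=> others; have [sA|sA] := boolP (s \in A); last first.
      rewrite (muN s sA) (nuN s sA) big1 ?(ltW eta0)// => t _.
      by rewrite subrr mul0r.
    have [[a1 a2 a3 a4] [[x1 w0 wa wM] [[_ aM mom _] _]]] := dP s sA.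
    rewrite (muA s sA) (nuA s sA).
    apply: (@coordinate_tv R S n (16 * M) m q q0 s (law0 (d s)) (law1 (d s)) (node (d s)) (center (d s))
      (width (d s)) (expR T) eta (4 * M) u E) => //.
    - by rewrite eq_sym im.
    - by move=> t; rewrite qA.
    - apply: (le_trans aM); have : tau s <= 1 / 64.
        by apply: le_trans tau64; rewrite (bigD1 s)//= lerDl sumr_ge0.
      move: M08; move: (tau s) (M0) => x y; lra.
    - by rewrite -expR0 ler_expR (le_trans _ T128).
    - exact: (chi_bound n1 T1 (lt_le_trans w0 wa) erefl wM (ltW L0) LM).
  have expE (w : 'I_S -> 'I_(16 * M) -> R) : w = mu \/ w = nu ->
      forall s, \sum_t w s t * expR (q s t * (2 * M0)^-1) <= expR (th s).
    move=> wE s; have [sA|sA] := boolP (s \in A); last first.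
      rewrite /th (negPf sA) expR0; under eq_bigr do rewrite qN// mul0r expR0 mulr1.
      by case: wE => ->; rewrite ?(hmu s).2 ?(hnu s).2.
    rewrite /th sA; under eq_bigr do rewrite (qA _ _ sA).
    have [_ [_ [_ [_ _ E0 E1]]]] := dP s sA.
    by case: wE => ->; rewrite ?(muA s sA) ?(nuA s sA).
  have lam0 : 0 < (2 * M0)^-1 by rewrite invr_gt0 mulr_gt0.
  have := @mixture_tv R S n (16 * M) m q q0 mu nu eta (2 * M0)^-1 th E hmu hnu lam0 (ltW eta0) br
    (expE mu (or_introl erefl)) (expE nu (or_intror erefl)).
  move=> /le_trans; apply; apply: le_trans (card_exp_le (ltnW S2) n2 C0 (erefl : T = _) CL).
  rewrite ler_wpM2l ?ler0n// lerD2l ler_expR.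
  rewrite (_ : \sum_s th s = 2 * (\sum_(i in A) tau i) / M0); last first.
    by rewrite /th sum_if mulr_sumr mulr_suml.
  exact: (tail_exponent n2 T128 erefl tau64).
have -> : (c2 / 128) ^+ 2 / 128 * rate ^+ 2 = Delta ^+ 2 / 128 by rewrite /Delta; field.
exact: (minimax_ge q0 qm hmu hnu D0 cut0 dE gap bounds tv).
Qed.

End lower_bound.

Theorem theorem5 (R : realType) (C : R) (hC : 0 < C) :
  exists C' a : R, 0 < C' /\ 0 < a /\
    forall (eps : R) (S n : nat) (P : S.-tuple R),
      0 <= eps -> (2 <= S)%N -> (2 <= n)%N ->
      C * ln S%:R <= ln n%:R ->
      distributions S P ->
      C' * (Num.sqrt (expR eps * ln n%:R / n%:R)
            + expR eps * Num.sqrt S%:R * ln n%:R / n%:R)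
        <= rate_sum n eps P ->
      ((a * rate_sum n eps P ^+ 2)%:E <= minimax_risk n eps P)%E.
Proof.
have [c c0 cP] := @coordinate_prior R.
pose c2 : R := c / 3 * (Num.sqrt (expR (- (C^-1 + 128)) / 2) / 3).
have c20 : 0 < c2.
  apply: mulr_gt0; first exact: divr_gt0.
  by apply: divr_gt0; [rewrite sqrtr_gt0; apply: divr_gt0; first exact: expR_gt0|].
exists (260 + 1536 / c2), ((c2 / 128) ^+ 2 / 128); split; last split.
- apply: addr_gt0; first by rewrite ltr0n.
  by apply: divr_gt0; [rewrite ltr0n|exact: c20].
- apply: divr_gt0; last by rewrite ltr0n.
  by apply: exprn_gt0; apply: divr_gt0; [exact: c20|rewrite ltr0n].
move=> eps S n P; apply: minimax_lower_bound => // M M0 tau M_gt0 M00 tau0.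
have [mu [nu [x [a [w H]]]]] := cP M M0 tau M_gt0 M00 tau0.
by exists (Prior mu nu x a w).
Qed.
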